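(* Let $(M,F)$ be a Finsler manifold admitting a concurrent $\pi$-vector field $\overline{\varphi}$ with associated $\pi$-form $\phi=i_{\overline{\varphi}}g$; put $\Phi=\phi(\overline{\eta})$ and $p^2=g(\overline\varphi,\overline\varphi)$. Let $\widehat F=\frac{F^2}{F-\Phi}$ on $\mathcal D=\{(x,y)\in TM : F(x,y)>\Phi(x,y)\}$ be a generalized $\phi$-Matsumoto metric (i.e. a conic pseudo-Finsler structure), with $F(1+2p^2)-3\Phi\ne0$ on $\mathcal D$, and set $$f_1=\frac{F(4\Phi-F)}{F(1+2p^2)-3\Phi},\qquad f_2=\frac{2F^3}{F(1+2p^2)-3\Phi}.$$ Then on $\mathcal D$ the Berwald connections $\widehat D^\circ$ of $\widehat F$ and $D^\circ$ of $F$ satisfy, for all $\pi$-vector fields $\overline W,\overline Z$: (1) $\widehat D^\circ_{\gamma\overline W}\overline Z=D^\circ_{\gamma\overline W}\overline Z$; (2) $$\begin{aligned}\widehat D^\circ_{\widehat\beta\overline W}\overline Z={}&D^\circ_{\beta\overline W}\overline Z-\frac12\big\{f_1\,D^\circ_{\gamma\overline W}\overline Z+d_Jf_1(\beta\overline W)\,D^\circ_{\gamma\overline\eta}\overline Z-d_Jf_1(\beta\overline W)\,\overline Z-d_Jf_1(\beta\overline Z)\,\overline W-d_Jf_2(\beta\overline W)\,D^\circ_{\gamma\overline\varphi}\overline Z\big\}\\&+\frac12\big\{dd_Jf_1(\gamma\overline Z,\beta\overline W)\,\overline\eta-dd_Jf_2(\gamma\overline Z,\beta\overline W)\,\overline\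varphi\big\}.\end{aligned}$$
   Context: Setting. $M$ is an $n$-dimensional paracompact smooth manifold, $\pi:TM\to M$ its tangent bundle, $\mathcal TM=TM\setminus\{0\}$ the slit tangent bundle. $\pi$-vector fields are smooth sections of the pullback of the bundle $TM\to M$ over $\mathcal TM$ (local basis $\overline{\partial}_i$); $\pi$-forms/tensors are the corresponding (dual) tensor sections. $\gamma$ is the natural injection (vertical lift) $\gamma(W^i\overline\partial_i)=W^i\partial_{y^i}$, $\rho(a^i\partial_{x^i}+b^i\partial_{y^i})=a^i\overline\partial_i$, $J=\gamma\circ\rho$, $\overline\eta(u)=(u,u)$ (i.e. $\overline\eta=y^i\overline\partial_i$), $\mathcal C=\gamma\overline\eta$, and $d_Jf=df\circ J$ for functions $f$. Finsler structure: $F:TM\to[0,\infty)$, $C^\infty$ on $\mathcal TM$, $C^0$ on $TM$, positively homogeneous of degree 1 in $y$, with $dd_JE$ of maximal rank, $E=\frac12F^2$. Metric tensor: $g(\rho W,\rho Z)=dd_JE(JW,Z)$ (it is positive definite). Geodesic spray $G$: the vector field with $JG=\mathcal C$, $[\mathcal C,G]=G$, $i_Gdd_JE=-dE$. Barthel connection $\Gamma=[J,G]$ (i.e. $\Gamma X=[JX,G]-J[X,G]$), projectors $h=\frac12(I+\Gamma)$, $v=\frac12(I-\Gamma)$, horizontal map $\beta=(\rho|_{\mathrm{Im}\,h})^{-1}$. Berwald connection $D^\circ$: $\gamma D^\circ_{hZ}\rho W=v[hZ,JW]$, $D^\circ_{\gamma\overline Z}\overline W=\rho[\gamma\overline Z,\beta\overline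 W]$. Cartan connection $\nabla$: determined by $2g(\nabla_{\gamma\overline X}\overline Y,\overline Z)=\gamma\overline X\cdot g(\overline Y,\overline Z)+g(\overline Y,\rho[\beta\overline Z,\gamma\overline X])+g(\overline Z,\rho[\gamma\overline X,\beta\overline Y])$ and $2g(\nabla_{\beta\overline X}\overline Y,\overline Z)=\beta\overline X\cdot g(\overline Y,\overline Z)+\beta\overline Y\cdot g(\overline Z,\overline X)-\beta\overline Z\cdot g(\overline X,\overline Y)-g(\overline X,\rho[\beta\overline Y,\beta\overline Z])+g(\overline Y,\rho[\beta\overline Z,\beta\overline X])+g(\overline Z,\rho[\beta\overline X,\beta\overline Y])$. Concurrent $\pi$-vector field: a non-vanishing $\pi$-vector field $\overline\varphi$ with $\nabla_{\beta\overline W}\overline\varphi=-\overline W=D^\circ_{\beta\overline W}\overline\varphi$ and $\nabla_{\gamma\overline W}\overline\varphi=0=D^\circ_{\gamma\overline W}\overline\varphi$ for all $\overline W$. Conic pseudo-Finsler structure on $M$: a smooth function to $[0,\infty)$ on a conic sub-bundle $\mathcal D\subset\mathcal TM$ (non-empty, open, invariant under scaling by positive reals, $\pi(\mathcal D)=M$, each fibre $\mathcal D_x$ connected), positively 1-homogeneous in $y$, whose form $dd_J(\frac12(\cdot)^2)$ has maximal rank. For the conic pseudo-Finsler structure $\widehat F$, the energy $\widehat E=\frac12\widehat F^2$, metric tensor $\widehat g$, geodesic spray $\widehat G$, Barthel connection $\widehat\Gamma$, projectors $\widehat h,\widehat v$, horizontal map $\widehat\beta$, Berwald connection $\widehat D^\circ$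 and Cartan connection $\widehat\nabla$ are defined on $\mathcal D$ by the same formulas as the corresponding unhatted objects of $F$. *)

(* Defs.v *)
From HB Require Import structures.
From mathcomp Require Import all_boot all_order all_algebra.
From mathcomp Require Import all_classical all_reals all_analysis.
Set Implicit Arguments.
Unset Strict Implicit.
Unset Printing Implicit Defensive.
Import Order.TTheory GRing.Theory Num.Theory.
Import numFieldNormedType.Exports.
Local Open Scope classical_set_scope.
Local Open Scope ring_scope.

(* The maps of class C^k on an open subset U of a normed space.  In finite
   dimension this inductive definition by directional derivatives is the usual
   one. *)
Fixpoint Ck (R : realType) (V W : normedModType R) (k : nat) (U : set V)
    (f : V -> W) : Prop :=
  match k with
  | 0%N => forall x, U x -> {for x, continuous f}
  | k'.+1 => (forall x, U x -> differentiable f x) /\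
             (forall v : V, Ck k' U (fun x => 'D_v f x))
  end.

Definition smooth_on (R : realType) (V W : normedModType R) (U : set V)
    (f : V -> W) : Prop := forall k, Ck k U f.

Definition paracompact (X : topologicalType) : Prop :=
  forall C : set (set X), C `<=` open -> \bigcup_(U in C) U = setT ->
  exists C' : set (set X),
    [/\ C' `<=` open, \bigcup_(U in C') U = setT,
        forall U', C' U' -> exists2 U, C U & U' `<=` U
      & forall x : X, exists2 N, nbhs x N &
          finite_set [set U' | C' U' /\ U' `&` N !=set0]].

(* A smooth n-manifold with a given atlas: chart i is a homeomorphism from
   chart_dom i onto an open subset of R^n, with inverse chart_inv i. *)
Record manifold (R : realType) (n : nat) := Manifold {
  carrier :> topologicalType;
  atlas : Type;
  chart_dom : atlas -> set carrier;
  chart : atlas -> carrier -> 'rV[R]_n;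
  chart_inv : atlas -> 'rV[R]_n -> carrier;
  chart_dom_open : forall i, open (chart_dom i);
  chart_dom_cover : \bigcup_i chart_dom i = setT;
  chart_open : forall i, open (chart i @` chart_dom i);
  chartK : forall i x, chart_dom i x -> chart_inv i (chart i x) = x;
  chart_continuous : forall i x, chart_dom i x -> {for x, continuous (chart i)};
  chart_inv_continuous : forall i a, (chart i @` chart_dom i) a ->
    {for a, continuous (chart_inv i)};
  transition_smooth : forall i j,
    smooth_on (chart i @` (chart_dom i `&` chart_dom j)) (chart j \o chart_inv i);
  carrier_hausdorff : hausdorff_space carrier;
  carrier_paracompact : paracompact carrier
}.

(* A point (x, y) of TR^n, and also a tangent vector
   a^i d/dx^i + b^i d/dy^i, written (a, b), at such a point. *)
Notation tpoint R n := ('rV[R]_n * 'rV[R]_n)%type.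

(* TM is obtained by gluing the open sets TU_i = tdom i of TR^n, one for each
   chart i of M, along the maps ttransition.  Subsets of TM, functions on TM,
   pi-vector fields and vector fields on TM are given by the families of their
   expressions in these natural charts; the predicates *_compat below are the
   transformation laws that make such a family a global object. *)
Definition tdom (R : realType) (n : nat) (M : manifold R n) (i : atlas M)
  : set (tpoint R n) := [set z | (chart i @` chart_dom i) z.1].

Definition slit (R : realType) (n : nat) (M : manifold R n) (i : atlas M)
  : set (tpoint R n) := [set z | tdom i z /\ z.2 != 0].

Definition overlap (R : realType) (n : nat) (M : manifold R n) (i j : atlas M)
  : set (tpoint R n) := [set z | (chart i @` (chart_dom i `&` chart_dom j)) z.1].

Definition transition (R : realType) (n : nat) (M : manifold R n)
  (i j : atlas M) : 'rV[R]_n -> 'rV[R]_n := chart j \o chart_inv i.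

Definition ttransition (R : realType) (n : nat) (M : manifold R n)
    (i j : atlas M) (z : tpoint R n) : tpoint R n :=
  (transition i j z.1, 'D_(z.2) (transition i j) z.1).

Definition set_compat (R : realType) (n : nat) (M : manifold R n)
    (A : atlas M -> set (tpoint R n)) : Prop :=
  forall i j z, overlap i j z -> (A i z <-> A j (ttransition i j z)).

Definition fun_compat (R : realType) (n : nat) (M : manifold R n)
    (A : atlas M -> set (tpoint R n)) (f : atlas M -> tpoint R n -> R) : Prop :=
  forall i j z, overlap i j z -> A i z -> f j (ttransition i j z) = f i z.

Definition pivf_compat (R : realType) (n : nat) (M : manifold R n)
    (A : atlas M -> set (tpoint R n))
    (W : atlas M -> tpoint R n -> 'rV[R]_n) : Prop :=
  forall i j z, overlap i j z -> A i z ->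
    W j (ttransition i j z) = 'D_(W i z) (transition i j) z.1.

Definition vf_compat (R : realType) (n : nat) (M : manifold R n)
    (A : atlas M -> set (tpoint R n))
    (X : atlas M -> tpoint R n -> tpoint R n) : Prop :=
  forall i j z, overlap i j z -> A i z ->
    X j (ttransition i j z) = 'D_(X i z) (ttransition i j) z.

(* From here to berwald, all objects are expressed in one natural chart of TM;
   these expressions do not depend on the chart. *)

Definition rho (R : realType) (n : nat) (X : tpoint R n -> tpoint R n)
  : tpoint R n -> 'rV[R]_n := fun z => (X z).1.

Definition vlift (R : realType) (n : nat) (W : tpoint R n -> 'rV[R]_n)
  : tpoint R n -> tpoint R n := fun z => (0, W z).

Definition Jop (R : realType) (n : nat) (X : tpoint R n -> tpoint R n)
  : tpoint R n -> tpoint R n := vlift (rho X).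

Definition etabar (R : realType) (n : nat) : tpoint R n -> 'rV[R]_n :=
  fun z => z.2.

Definition liouville (R : realType) (n : nat) : tpoint R n -> tpoint R n :=
  vlift (@etabar R n).

Definition lie_br (R : realType) (n : nat) (X Y : tpoint R n -> tpoint R n)
  : tpoint R n -> tpoint R n := fun z => 'D_(X z) Y z - 'D_(Y z) X z.

Definition dact (R : realType) (n : nat) (X : tpoint R n -> tpoint R n)
    (f : tpoint R n -> R) : tpoint R n -> R := fun z => 'D_(X z) f z.

Definition dJ (R : realType) (n : nat) (f : tpoint R n -> R)
    (X : tpoint R n -> tpoint R n) : tpoint R n -> R := dact (Jop X) f.

(* dw(X, Y) = X.w(Y) - Y.w(X) - w([X, Y]), without the factor 1/2 *)
Definition ddJ (R : realType) (n : nat) (f : tpoint R n -> R)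
    (X Y : tpoint R n -> tpoint R n) : tpoint R n -> R :=
  fun z => dact X (dJ f Y) z - dact Y (dJ f X) z - dJ f (lie_br X Y) z.

Definition energy (R : realType) (n : nat) (F : tpoint R n -> R)
  : tpoint R n -> R := fun z => 2^-1 * F z ^+ 2.

(* g(rho X, rho Y) = dd_J E (J X, Y), for the vector fields X, Y with zero
   d/dy-components that project to W and Z; dd_J E (J X, Y) depends on rho X
   and rho Y only. *)
Definition fmetric (R : realType) (n : nat) (E : tpoint R n -> R)
    (W Z : tpoint R n -> 'rV[R]_n) : tpoint R n -> R :=
  ddJ E (vlift W) (fun z => (Z z, 0)).

Definition tbasis (R : realType) (n : nat) (k : 'I_(n + n)) : tpoint R n :=
  match fintype.split k with
  | inl i => (delta_mx 0 i, 0)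
  | inr j => (0, delta_mx 0 j)
  end.

(* dd_J f, a 2-form on a space of dimension 2n, has maximal rank at z *)
Definition ddJ_max_rank (R : realType) (n : nat) (f : tpoint R n -> R)
    (z : tpoint R n) : Prop :=
  \rank (\matrix_(k < n + n, l < n + n)
    ddJ f (cst (tbasis R k)) (cst (tbasis R l)) z) = (n + n)%N.

(* The Frolicher-Nijenhuis bracket Gamma = [J, G] *)
Definition barthel (R : realType) (n : nat) (G X : tpoint R n -> tpoint R n)
  : tpoint R n -> tpoint R n := fun z => lie_br (Jop X) G z - Jop (lie_br X G) z.

Definition hproj (R : realType) (n : nat) (G X : tpoint R n -> tpoint R n)
  : tpoint R n -> tpoint R n := fun z => 2^-1 *: (X z + barthel G X z).

Definition vproj (R : realType) (n : nat) (G X : tpoint R n -> tpoint R n)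
  : tpoint R n -> tpoint R n := fun z => 2^-1 *: (X z - barthel G X z).

(* The fibre of Im h at z *)
Definition hspace (R : realType) (n : nat) (G : tpoint R n -> tpoint R n)
    (z : tpoint R n) : set (tpoint R n) :=
  [set u | exists2 X, differentiable X z & hproj G X z = u].

(* hmap is beta, the inverse of the restriction of rho to Im h. *)
Definition hmap (R : realType) (n : nat) (G : tpoint R n -> tpoint R n)
    (W : tpoint R n -> 'rV[R]_n) : tpoint R n -> tpoint R n :=
  fun z => xget 0 [set u | hspace G z u /\ u.1 = W z].

(* D_X W = D_(h X) W + D_(v X) W.  For W = rho Y we have J Y = vlift W, so
   vlift (D_(h X) W) = v [h X, vlift W], where vlift^-1 takes the
   d/dy-component; and D_(v X) W = rho [v X, hmap W]. *)
Definition berwald (R : realType) (n : nat) (G X : tpoint R n -> tpoint R n)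
    (W : tpoint R n -> 'rV[R]_n) : tpoint R n -> 'rV[R]_n :=
  fun z => (vproj G (lie_br (hproj G X) (vlift W)) z).2
           + rho (lie_br (vproj G X) (hmap G W)) z.

Definition geodesic_spray (R : realType) (n : nat) (M : manifold R n)
    (A : atlas M -> set (tpoint R n)) (E : atlas M -> tpoint R n -> R)
    (G : atlas M -> tpoint R n -> tpoint R n) : Prop :=
  [/\ forall i, smooth_on (A i) (G i),
      vf_compat A G,
      forall i z, A i z -> Jop (G i) z = liouville z,
      forall i z, A i z -> lie_br (@liouville R n) (G i) z = G i z
    & forall i (X : tpoint R n -> tpoint R n), smooth_on (A i) X ->
        forall z, A i z -> ddJ (E i) (G i) X z = - dact X (E i) z].

Definition finsler (R : realType) (n : nat) (M : manifold R n)
    (F : atlas M -> tpoint R n -> R) : Prop :=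
  [/\ fun_compat (@tdom R n M) F,
      forall i z, tdom i z -> 0 <= F i z,
      (forall i, smooth_on (slit i) (F i)) /\
        (forall i z, tdom i z -> {for z, continuous (F i)}),
      forall i z (t : R), tdom i z -> 0 < t -> F i (z.1, t *: z.2) = t * F i z
    & forall i z, slit i z ->
        ddJ_max_rank (energy (F i)) z /\
        (forall w : 'rV[R]_n, w != 0 ->
           0 < fmetric (energy (F i)) (cst w) (cst w) z)].

Definition conic_subbundle (R : realType) (n : nat) (M : manifold R n)
    (A : atlas M -> set (tpoint R n)) : Prop :=
  [/\ set_compat A,
      (forall i, open (A i)) /\ (forall i, A i `<=` slit i),
      exists i, A i !=set0,
      forall i z (t : R), A i z -> 0 < t -> A i (z.1, t *: z.2)
    & forall i a, (chart i @` chart_dom i) a ->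
        [set y | A i (a, y)] !=set0 /\ connected [set y | A i (a, y)]].

Definition conic_pseudo_finsler (R : realType) (n : nat) (M : manifold R n)
    (A : atlas M -> set (tpoint R n)) (F : atlas M -> tpoint R n -> R) : Prop :=
  [/\ conic_subbundle A,
      fun_compat A F /\ (forall i, smooth_on (A i) (F i)),
      forall i z, A i z -> 0 <= F i z,
      forall i z (t : R), A i z -> 0 < t -> F i (z.1, t *: z.2) = t * F i z
    & forall i z, A i z -> ddJ_max_rank (energy (F i)) z].

(* nabla i X Y is the expression of nabla_X Y in chart i.  The two formulas
   determine nabla_X Y for X vertical and X horizontal, as g is nondegenerate;
   that is all that is used of the Cartan connection. *)
Definition cartan_connection (R : realType) (n : nat) (M : manifold R n)
    (F : atlas M -> tpoint R n -> R) (G : atlas M -> tpoint R n -> tpoint R n)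
    (nabla : atlas M -> (tpoint R n -> tpoint R n) ->
             (tpoint R n -> 'rV[R]_n) -> (tpoint R n -> 'rV[R]_n)) : Prop :=
  (forall i (X : tpoint R n -> tpoint R n) (Y : tpoint R n -> 'rV[R]_n),
     smooth_on (slit i) X -> smooth_on (slit i) Y ->
     smooth_on (slit i) (nabla i X Y)) /\
  forall i (X Y Z : tpoint R n -> 'rV[R]_n),
  smooth_on (slit i) X -> smooth_on (slit i) Y -> smooth_on (slit i) Z ->
  forall z, slit i z ->
  let g := fmetric (energy (F i)) in
  let b := hmap (G i) in
  2 * g (nabla i (vlift X) Y) Z z =
    dact (vlift X) (g Y Z) z
    + g Y (rho (lie_br (b Z) (vlift X))) z
    + g Z (rho (lie_br (vlift X) (b Y))) z
  /\
  2 * g (nabla i (b X) Y) Z z =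
    dact (b X) (g Y Z) z + dact (b Y) (g Z X) z - dact (b Z) (g X Y) z
    - g X (rho (lie_br (b Y) (b Z))) z
    + g Y (rho (lie_br (b Z) (b X))) z
    + g Z (rho (lie_br (b X) (b Y))) z.

Definition concurrent (R : realType) (n : nat) (M : manifold R n)
    (G : atlas M -> tpoint R n -> tpoint R n)
    (nabla : atlas M -> (tpoint R n -> tpoint R n) ->
             (tpoint R n -> 'rV[R]_n) -> (tpoint R n -> 'rV[R]_n))
    (phi : atlas M -> tpoint R n -> 'rV[R]_n) : Prop :=
  [/\ forall i, smooth_on (slit i) (phi i),
      pivf_compat (@slit R n M) phi,
      forall i z, slit i z -> phi i z != 0
    & forall i (W : tpoint R n -> 'rV[R]_n), smooth_on (slit i) W ->
      forall z, slit i z ->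
      [/\ nabla i (hmap (G i) W) (phi i) z = - W z,
          berwald (G i) (hmap (G i) W) (phi i) z = - W z,
          nabla i (vlift W) (phi i) z = 0
        & berwald (G i) (vlift W) (phi i) z = 0]].

(* phi(etabar), for the pi-form phi = g(phi, .) *)
Definition phi_eta (R : realType) (n : nat) (F : tpoint R n -> R)
    (phi : tpoint R n -> 'rV[R]_n) : tpoint R n -> R :=
  fmetric (energy F) phi (@etabar R n).

Definition psq (R : realType) (n : nat) (F : tpoint R n -> R)
    (phi : tpoint R n -> 'rV[R]_n) : tpoint R n -> R :=
  fmetric (energy F) phi phi.

(* On the zero section F = 0 and phi_eta, linear in y, extends by 0; so
   F > phi_eta holds on nonzero vectors only. *)
Definition matsumoto_dom (R : realType) (n : nat) (M : manifold R n)
    (F : atlas M -> tpoint R n -> R) (phi : atlas M -> tpoint R n -> 'rV[R]_n)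
    (i : atlas M) : set (tpoint R n) :=
  [set z | slit i z /\ phi_eta (F i) (phi i) z < F i z].

Definition matsumoto (R : realType) (n : nat) (F : tpoint R n -> R)
    (phi : tpoint R n -> 'rV[R]_n) : tpoint R n -> R :=
  fun z => F z ^+ 2 / (F z - phi_eta F phi z).

Definition matsumoto_den (R : realType) (n : nat) (F : tpoint R n -> R)
    (phi : tpoint R n -> 'rV[R]_n) : tpoint R n -> R :=
  fun z => F z * (1 + 2 * psq F phi z) - 3 * phi_eta F phi z.

(* Main.v *)
(* Work in a natural chart and write G = (y, S), so that the horizontal lift of
   w is w + (1/2) d_w S, with d_w the vertical derivative along w.
   The Berwald connection of F is then
   D_(beta W) Z = (beta W).Z - (1/2) d_Z d_W S, and the theorem follows
   once one knows that Ghat = G - f1 C + f2 gamma(phi).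

   Since E is constant along horizontal curves, the spray equation of Ehat
   reads, for Ghat = G + gamma(P),
     d_P d_c Ehat = 2 (beta c).Ehat - d_c (G.Ehat)   for all c.
   As phi is concurrent, Phi is linear in y and (beta c).Phi = - d_c E, and for
   Ehat = e(F, Phi) the right-hand side becomes F^2 d_c (de/dPhi).  The Hessian
   of Ehat being nondegenerate, P is determined by this equation, and
   P = - f1 eta + f2 phi is checked to be a solution. *)
Require Import Defs.
From HB Require Import structures.
From mathcomp Require Import all_boot all_order all_algebra.
From mathcomp Require Import all_classical all_reals all_analysis.
From mathcomp Require Import ring lra.
Import Order.TTheory GRing.Theory Num.Theory.
Import numFieldNormedType.Exports.
Local Open Scope classical_set_scope.
Local Open Scope ring_scope.
Set Implicit Arguments.
Unset Strict Implicit.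
Unset Printing Implicit Defensive.

(** * Directional derivatives and smooth maps *)

(** The functions f1 and f2 come from the ansatz P = a eta + b phi. In d_P d_c Ehat = F^2 d_c
    (de/dPhi), comparing the coefficients of d_c F and of d_c Phi gives two linear equations in a
    and b; their determinant is F (1 + 2 p^2) - 3 Phi up to sign and powers of F and F - Phi, and a
    = - f1, b = f2 is the solution. Linearity of Phi in y rests on two conditions on phi: the
    vertical Berwald one makes phi independent of y, and the vertical Cartan one then makes g(phi,
    d), which is d_d Phi, independent of y. Constancy of E along horizontal curves comes from G.E =
    0, a consequence of homogeneity and of the spray equation, since the derivative of G.E along
    gamma(c) is 2 (beta c).E. The recurrent difficulty is that the fields vary: differentiating z ->
    'D_(X z) f z also differentiates X. Once that term is split off ([derive_field]), the brackets
    in the definitions reduce to iterated derivatives along fixed vectors, which commute on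
    functions. *)

Section DirectionalDerivatives.
Context {R : realType}.

Lemma near0_shift (V : normedModType R) (P : set V) (x : V) :
  (\near x, P x) -> \forall h \near (0 : V), P (h + x).
Proof. by rewrite (near_shift 0) subr0. Qed.

(** The first-order expansion of [f] at [x] is also one of [g], and the continuous linear map in
    such an expansion is the differential. *)
Lemma differentiable_eq_on (V W : normedModType R) (U : set V) (f g : V -> W) x :
  open U -> (forall z, U z -> f z = g z) -> U x ->
  differentiable f x -> differentiable g x.
Proof.
move=> oU fg Ux df.
have gE : g \o shift x = cst (g x) + 'd f x +o_ 0 id.
  apply/eqaddoP => _/posnumP[e].
  have [_ /eqaddoP/(_ e%:num (gt0 e)) fE] := (diff_locallyP x f).1 df.
  have Us : \forall h \near (0 : V), U (h + x).
    by apply: near0_shift; exact: open_nbhs_nbhs.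
  apply: filterS2 fE Us => h /= fh Uh.
  by rewrite !fctE /= -(fg _ Uh) -(fg _ Ux); move: fh; rewrite !fctE.
apply/diff_locallyP; rewrite (diff_unique (diff_continuous df) gE).
by split; first exact: diff_continuous df.
Qed.

Lemma derive_eq_on (V W : normedModType R) (U : set V) (f g : V -> W) x v :
  open U -> (forall z, U z -> f z = g z) -> U x -> 'D_v f x = 'D_v g x.
Proof.
move=> oU fg Ux; apply: near_eq_derive.
by apply: filterS (open_nbhs_nbhs (conj oU Ux)) => z Uz; exact: fg.
Qed.

Lemma derive_lin (V W W' : normedModType R) (L : {linear W -> W'})
    (f : V -> W) x v :
  continuous L -> differentiable f x ->
  differentiable (fun z => L (f z)) x /\
  'D_v (fun z => L (f z)) x = L ('D_v f x).
Proof.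
move=> cL df.
have dL : differentiable L (f x) by exact: linear_differentiable.
have dLf : differentiable (L \o f) x by exact: differentiable_comp.
by split=> //; rewrite (deriveE _ dLf) diff_comp//= diff_lin// deriveE.
Qed.

Lemma derive_pair (V W W' : normedModType R) (f : V -> W) (g : V -> W') x v :
  differentiable f x -> differentiable g x ->
  'D_v (fun z => (f z, g z)) x = ('D_v f x, 'D_v g x).
Proof.
move=> df dg; rewrite (deriveE _ (differentiable_pair df dg)) diff_pair//.
by rewrite !deriveE.
Qed.

(** Registers scaling as a bilinear map, so that the differential of a bilinear map yields the
    Leibniz rule for [f z *: g z]. *)
Lemma scale_is_bilinear (W : normedModType R) :
  bilinear_for
    (GRing.Scale.Law.clone _ _ *:%R _) (GRing.Scale.Law.clone _ _ *:%R _)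
    (@GRing.scale R W).
Proof.
split=> [u'|u] a x y /=.
- by rewrite scalerDl scalerA.
- by rewrite scalerDr !scalerA mulrC.
Qed.

HB.instance Definition _ (W : normedModType R) :=
  bilinear_isBilinear.Build R R W W _ _ (@GRing.scale R W)
    (scale_is_bilinear W).

Lemma derive_scale (V W : normedModType R) (f : V -> R) (g : V -> W) x v :
  differentiable f x -> differentiable g x ->
  differentiable (fun z => f z *: g z) x /\
  'D_v (fun z => f z *: g z) x = 'D_v f x *: g x + f x *: 'D_v g x.
Proof.
move=> df dg.
have cs : continuous (fun p : R * W => p.1 *: p.2) by exact: scale_continuous.
have db : differentiable (fun p : R * W => p.1 *: p.2) (f x, g x).
  exact: (@differentiable_bilin _ _ _ _ (@GRing.scale R W)).
have dfg := differentiable_pair df dg.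
have dc := differentiable_comp dfg db.
split; first exact: dc.
rewrite (deriveE v dc) diff_comp// diff_pair//=.
rewrite (@diff_bilin _ _ _ _ (@GRing.scale R W))//=.
by rewrite !deriveE// addrC.
Qed.

Lemma derive_mul (V : normedModType R) (f g : V -> R) x v :
  differentiable f x -> differentiable g x ->
  differentiable (fun z => f z * g z) x /\
  'D_v (fun z => f z * g z) x = 'D_v f x * g x + f x * 'D_v g x.
Proof. exact: derive_scale. Qed.

Lemma derive_inv (V : normedModType R) (f : V -> R) x v :
  f x != 0 -> differentiable f x ->
  'D_v (fun z => (f z)^-1) x = - (f x)^-1 * (f x)^-1 * 'D_v f x.
Proof.
move=> f0 df; rewrite (deriveE v (differentiableV df f0)) diffV//= deriveE//.
by rewrite /= -exprVn expr2 mulNr.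
Qed.

End DirectionalDerivatives.

Section SmoothMaps.
Context {R : realType} {V : normedModType R} {U : set V}.
Hypothesis oU : open U.

Lemma Ck_eq_on (W : normedModType R) k (f g : V -> W) :
  (forall z, U z -> f z = g z) -> Ck k U f -> Ck k U g.
Proof.
elim: k f g => [|k IH] f g fg /= => [cf x Ux|[df Df]].
  apply: cvg_trans (near_eq_cvg _) _.
    by apply: filterS (open_nbhs_nbhs (conj oU Ux)) => z Uz; exact: fg.
  by rewrite -fg//; exact: cf.
split=> [x Ux|v]; first exact: differentiable_eq_on fg Ux (df _ Ux).
by apply: IH (Df v) => z Uz; exact: derive_eq_on fg Uz.
Qed.

Lemma smooth_eq_on (W : normedModType R) (f g : V -> W) :
  (forall z, U z -> f z = g z) -> smooth_on U f -> smooth_on U g.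
Proof. by move=> fg sf k; exact: Ck_eq_on fg (sf k). Qed.

Lemma smooth_differentiable (W : normedModType R) (f : V -> W) x :
  smooth_on U f -> U x -> differentiable f x.
Proof. by move=> /(_ 1%N)[+ _]; apply. Qed.

Lemma smooth_derive (W : normedModType R) (f : V -> W) v :
  smooth_on U f -> smooth_on U (fun z => 'D_v f z).
Proof. by move=> sf k; have [_] := sf k.+1; apply. Qed.

Lemma smooth_subset (W : normedModType R) (U' : set V) (f : V -> W) :
  U' `<=` U -> smooth_on U f -> smooth_on U' f.
Proof.
move=> sU sf k; have := sf k; elim: k f {sf} => [|k IH] f /= => [cf x /sU|[df Df]].
  exact: cf.
by split=> [x /sU|v]; [exact: df|exact: IH].
Qed.

Lemma CkD (W : normedModType R) k (f g : V -> W) :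
  Ck k U f -> Ck k U g -> Ck k U (fun z => f z + g z).
Proof.
elim: k f g => [|k IH] f g /= => [cf cg x Ux|[df Df] [dg Dg]].
  by apply: continuousD; [exact: cf|exact: cg].
split=> [x Ux|v]; first exact: differentiableD (df _ Ux) (dg _ Ux).
apply: Ck_eq_on (IH _ _ (Df v) (Dg v)) => z Uz.
by rewrite [RHS]deriveD//; apply: diff_derivable; [exact: df|exact: dg].
Qed.

(** The Leibniz rule splits the derivative of a product into two products, so a class such as all
    [f z *: g z] is stable under derivation only up to a sum of two members. That is enough, since
    each [Ck k] is closed under sums. *)
Lemma smooth_coind (W : normedModType R) (P : (V -> W) -> Prop) :
  (forall f, P f -> (forall x, U x -> differentiable f x) /\
     forall v, exists g h, [/\ P g, P h &
       forall x, U x -> 'D_v f x = g x + h x]) ->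
  forall f, P f -> smooth_on U f.
Proof.
move=> HP f Pf k; elim: k f Pf => [|k IH] f /HP[df Df].
  by move=> x Ux; apply: differentiable_continuous; exact: df.
split=> // v; have [g [h [Pg Ph gh]]] := Df v.
by apply: Ck_eq_on (CkD (IH _ Pg) (IH _ Ph)) => z Uz; rewrite gh.
Qed.

Lemma smooth_cst (W : normedModType R) (w : W) : smooth_on U (fun=> w).
Proof.
apply: (smooth_coind (P := fun f => exists w, f = fun=> w)); last by exists w.
move=> _ [a ->]; split=> [x _|v]; first exact: differentiable_cst.
exists (fun=> 0), (fun=> 0); split; [by exists 0|by exists 0|move=> x _].
by rewrite addr0 derive_cst.
Qed.

Lemma smooth_lin (W W' : normedModType R) (L : {linear W -> W'}) (f : V -> W) :
  continuous L -> smooth_on U f -> smooth_on U (fun z => L (f z)).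
Proof.
move=> cL sf; apply: (smooth_coind
    (P := fun h => exists2 f, smooth_on U f & h = fun z => L (f z))); last first.
  by exists f.
move=> _ [{sf}f sf ->]; split=> [x Ux|v].
  exact: (derive_lin 0 cL (smooth_differentiable sf Ux)).1.
exists (fun z => L ('D_v f z)), (fun=> L 0); split.
- by exists (fun z => 'D_v f z) => //; exact: smooth_derive.
- by exists (fun=> 0) => //; exact: smooth_cst.
- move=> x Ux; rewrite linear0 addr0.
  exact: (derive_lin v cL (smooth_differentiable sf Ux)).2.
Qed.

Lemma smoothD (W : normedModType R) (f g : V -> W) :
  smooth_on U f -> smooth_on U g -> smooth_on U (fun z => f z + g z).
Proof. by move=> sf sg k; exact: CkD. Qed.

Lemma smooth_pair (W W' : normedModType R) (f : V -> W) (g : V -> W') :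
  smooth_on U f -> smooth_on U g -> smooth_on U (fun z => (f z, g z)).
Proof.
move=> sf sg; apply: (smooth_coind (P := fun h => exists f g,
  [/\ smooth_on U f, smooth_on U g & h = fun z => (f z, g z)])); last first.
  by exists f, g.
move=> _ [{sf}f [{sg}g [sf sg ->]]]; split=> [x Ux|v].
  exact: differentiable_pair (smooth_differentiable sf Ux)
    (smooth_differentiable sg Ux).
exists (fun z => ('D_v f z, 'D_v g z)), (fun=> 0); split.
- by exists (fun z => 'D_v f z), (fun z => 'D_v g z); split=> //;
    exact: smooth_derive.
- by exists (fun=> 0), (fun=> 0); split=> //; exact: smooth_cst.
- move=> x Ux; rewrite addr0.
  exact: derive_pair (smooth_differentiable sf Ux) (smooth_differentiable sg Ux).
Qed.

Lemma smooth_scale (W : normedModType R) (f : V -> R) (g : V -> W) :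
  smooth_on U f -> smooth_on U g -> smooth_on U (fun z => f z *: g z).
Proof.
move=> sf sg; apply: (smooth_coind (P := fun h => exists (f : V -> R) g,
  [/\ smooth_on U f, smooth_on U g & h = fun z => f z *: g z])); last first.
  by exists f, g.
move=> _ [{sf}f [{sg}g [sf sg ->]]]; split=> [x Ux|v].
  exact: (derive_scale 0 (smooth_differentiable sf Ux)
    (smooth_differentiable sg Ux)).1.
exists (fun z => 'D_v f z *: g z), (fun z => f z *: 'D_v g z); split.
- by exists (fun z => 'D_v f z), g; split=> //; exact: smooth_derive.
- by exists f, (fun z => 'D_v g z); split=> //; exact: smooth_derive.
- move=> x Ux; exact: (derive_scale v (smooth_differentiable sf Ux)
    (smooth_differentiable sg Ux)).2.
Qed.

Lemma smoothM (f g : V -> R) :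
  smooth_on U f -> smooth_on U g -> smooth_on U (fun z => f z * g z).
Proof. exact: smooth_scale. Qed.

Lemma smoothN (W : normedModType R) (f : V -> W) :
  smooth_on U f -> smooth_on U (fun z => - f z).
Proof.
move=> sf; apply: (@smooth_eq_on _ (fun z => -1 *: f z)) => [z _|].
  by rewrite scaleN1r.
by apply: smooth_scale => //; exact: smooth_cst.
Qed.

Lemma smoothB (W : normedModType R) (f g : V -> W) :
  smooth_on U f -> smooth_on U g -> smooth_on U (fun z => f z - g z).
Proof. by move=> sf sg; apply: smoothD => //; exact: smoothN. Qed.

Lemma smoothX (f : V -> R) k :
  smooth_on U f -> smooth_on U (fun z => f z ^+ k).
Proof.
move=> sf; elim: k => [|k IH]; first exact: smooth_cst.
by apply: smooth_eq_on (smoothM sf IH) => z _; rewrite exprS.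
Qed.

Lemma smooth_sum (W : normedModType R) k (f : 'I_k -> V -> W) :
  (forall i, smooth_on U (f i)) -> smooth_on U (fun z => \sum_i f i z).
Proof.
elim: k f => [|k IH] f sf.
  by apply: smooth_eq_on (smooth_cst 0) => z _; rewrite big_ord0.
apply: smooth_eq_on (smoothD (IH _ (fun i => sf (widen_ord (leqnSn k) i)))
  (sf ord_max)) => z _; by rewrite big_ord_recr.
Qed.

(** The derivative of f^-1 involves f^-2, so the class to which coinduction applies has to contain
    all powers: it consists of the products [q k z * g z] with [g] smooth, where [q k] is f^-k. *)
Lemma smoothV (f : V -> R) :
  (forall z, U z -> f z != 0) -> smooth_on U f ->
  smooth_on U (fun z => (f z)^-1).
Proof.
move=> f0 sf.
pose q k z := (f z)^-1 ^+ k.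
have dq k x v : U x -> differentiable (q k) x /\
    'D_v (q k) x = q k.+1 x * (- k%:R * 'D_v f x).
  move=> Ux; have dfV := differentiableV (smooth_differentiable sf Ux) (f0 _ Ux).
  elim: k => [|k [dk Dk]].
    have q0 : q 0%N = cst 1 by apply/funext => z; rewrite /q expr0.
    by rewrite q0 derive_cst oppr0 mul0r mulr0; split=> //; exact: differentiable_cst.
  have qS : q k.+1 = fun z => (f z)^-1 * q k z.
    by apply/funext => z; rewrite /q exprS.
  have [d1 D1] := derive_mul v dfV dk.
  rewrite [in LHS]qS {1}qS D1 Dk derive_inv//; last 2 first.
  - exact: f0.
  - exact: smooth_differentiable.
  split=> //; rewrite /q !exprS -natr1; ring.
apply: (smooth_coind (P := fun h => exists k g, smooth_on U g /\
    h = fun z => q k z * g z)); last first.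
  exists 1%N, (fun=> 1); split; first exact: smooth_cst.
  by apply/funext => z; rewrite /q expr1 mulr1.
move=> _ [k [g [sg ->]]]; split=> [x Ux|v].
  exact: (derive_mul 0 (dq k x 0 Ux).1 (smooth_differentiable sg Ux)).1.
exists (fun z => q k.+1 z * (- k%:R * 'D_v f z * g z)),
  (fun z => q k z * 'D_v g z); split.
- exists k.+1, (fun z => - k%:R * 'D_v f z * g z); split=> //.
  by apply: smoothM => //; apply: smoothM; [exact: smooth_cst|exact: smooth_derive].
- by exists k, (fun z => 'D_v g z); split=> //; exact: smooth_derive.
- move=> x Ux; have [dk Dk] := dq k x v Ux.
  rewrite (derive_mul v dk (smooth_differentiable sg Ux)).2 Dk; ring.
Qed.

End SmoothMaps.

(** * Symmetry of second derivatives *)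

Section SymmetryOfSecondDerivatives.
Context {R : realType} {V : normedModType R} {U : set V}.
Hypothesis oU : open U.

Lemma is_derive_line (f : V -> R) (u w : V) (s : R) :
  derivable f (s *: u + w) u ->
  is_derive s 1 (fun s => f (s *: u + w)) ('D_u f (s *: u + w)).
Proof.
move=> df.
have E : (fun h : R => h^-1 *: (((fun s => f (s *: u + w)) \o shift s) (h *: 1)
      - f (s *: u + w))) =
    (fun h => h^-1 *: ((f \o shift (s *: u + w)) (h *: u) - f (s *: u + w))).
  by apply/funext => h /=; rewrite [h *: 1]mulr1 scalerDl addrA.
by split; rewrite /derivable /derive E.
Qed.

(** The second difference is [g t - g 0] for g(s) = f(su + tv + x) - f(su + x). The mean value
    theorem turns it into t times the difference of [h] = d_u f at cu + tv + x and cu + x, and the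
    differential of [h] at x evaluates this up to o(t). *)
Lemma second_difference (f : V -> R) x u v (e : R) : 0 < e ->
  smooth_on U f -> U x ->
  \forall t \near (0 : R)^'+,
    `|f (t *: u + t *: v + x) - f (t *: u + x) - f (t *: v + x) + f x
      - t ^+ 2 * 'D_v (fun z => 'D_u f z) x| <= e * t ^+ 2.
Proof.
move=> e0 sf Ux; pose h z := 'D_u f z.
have dh : differentiable h x.
  exact: smooth_differentiable (smooth_derive u sf) Ux.
(* For 0 <= c <= t the norms of cu + tv and cu add up to at most t K; the added 1 keeps [K] positive
   when [u] and [v] vanish. *)
pose K := 2 * `|u| + `|v| + 1.
have K0 : 0 < K by rewrite /K addrC ltr_pwDl// addr_ge0// mulr_ge0.
have := (diff_locallyP x h).1 dh => -[_ /eqaddoP/(_ _ (divr_gt0 e0 K0)) hE].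
have : \forall k \near (0 : V), `|h (k + x) - h x - 'd h x k| <= e / K * `|k|
    /\ U (k + x).
  apply: filterS2 hE (near0_shift (open_nbhs_nbhs (conj oU Ux))) => k /=.
  by rewrite !fctE /= opprD addrA.
move=> /nbhs_normP[r /= r0 rP].
have {}rP k : `|k| < r -> `|h (k + x) - h x - 'd h x k| <= e / K * `|k|
    /\ U (k + x).
  by move=> kr; apply: rP; rewrite /= sub0r normrN.
near=> t.
have t0 : 0 < t by near: t; exact: nbhs_right_gt.
have tK : t * K < r.
  by rewrite -ltr_pdivlMr//; near: t; apply: nbhs_right_lt; exact: divr_gt0.
have su_lt s : 0 <= s <= t -> `|s *: u| < r.
  move=> /andP[s0 st]; rewrite normrZ ger0_norm//; apply: le_lt_trans tK.
  apply: ler_pM => //; rewrite /K; have := normr_ge0 u; have := normr_ge0 v; lra.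
have sutv_lt s : 0 <= s <= t -> `|s *: u + t *: v| < r.
  move=> /andP[s0 st]; apply: le_lt_trans (ler_normD _ _) _; apply: le_lt_trans tK.
  rewrite !normrZ ger0_norm// gtr0_norm//.
  have : s * `|u| <= t * `|u| by apply: ler_wpM2r.
  have : 0 <= t * `|u| by rewrite mulr_ge0// ltW.
  rewrite /K; nra.
pose g s := f (s *: u + (t *: v + x)) - f (s *: u + x).
have dg s : 0 <= s <= t -> is_derive s 1 g
    (h (s *: u + (t *: v + x)) - h (s *: u + x)).
  move=> st; apply: is_deriveB; apply: is_derive_line; apply: diff_derivable;
    apply: smooth_differentiable => //.
  - by rewrite addrA; exact: (rP _ (sutv_lt _ st)).2.
  - exact: (rP _ (su_lt _ st)).2.
have [||c] := @MVT R g (fun s => h (s *: u + (t *: v + x)) - h (s *: u + x)) 0 t t0.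
- by move=> s; rewrite in_itv/= => /andP[/ltW s0 /ltW st]; apply: dg; rewrite s0.
- apply: derivable_within_continuous => s; rewrite in_itv/= => st.
  exact: (@ex_derive _ _ _ _ _ _ _ (dg s st)).
rewrite in_itv/= subr0 => /andP[c0 ct] gE.
have cP : 0 <= c <= t by rewrite !ltW.
have [H1 _] := rP _ (sutv_lt _ cP).
have [H2 _] := rP _ (su_lt _ cP).
have -> : f (t *: u + t *: v + x) - f (t *: u + x) - f (t *: v + x) + f x
    = g t - g 0.
  rewrite /g !scale0r !add0r addrA; ring.
rewrite gE (deriveE _ dh) addrA.
have dlin : 'd h x (c *: u + t *: v) = 'd h x (c *: u) + t * 'd h x v.
  by rewrite linearD; congr (_ + _); rewrite linearZ.
rewrite dlin in H1.
set A := h (c *: u + t *: v + x) in H1 *; set B := h (c *: u + x) in H2 *.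
set p := 'd h x (c *: u) in H1 H2; set q := 'd h x v in H1 *.
have -> : (A - B) * t - t ^+ 2 * q =
    t * ((A - h x - (p + t * q)) - (B - h x - p)) by ring.
rewrite normrM gtr0_norm// [e * _]mulrC expr2 -mulrA ler_pM2l//.
apply: le_trans (ler_normB _ _) _; apply: le_trans (lerD H1 H2) _.
rewrite -mulrDr.
have NK : `|c *: u + t *: v| + `|c *: u| <= t * K.
  apply: le_trans (lerD (ler_normD _ _) (lexx _)) _.
  rewrite !normrZ ger0_norm ?(ltW c0)// gtr0_norm//.
  have : c * `|u| <= t * `|u| by apply: ler_wpM2r => //; exact: ltW.
  rewrite /K; nra.
apply: le_trans (ler_wpM2l _ NK) _; first by rewrite divr_ge0// ltW.
by rewrite [t * K]mulrC mulrA divfK ?gt_eqF// mulrC.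
Unshelve. all: by end_near. Qed.

(** The second difference is symmetric in [u] and [v], while [second_difference] estimates it by
    either of the two iterated derivatives; each estimate contributes e / 2. *)
Lemma derive_sym (f : V -> R) x u v : smooth_on U f -> U x ->
  'D_u (fun z => 'D_v f z) x = 'D_v (fun z => 'D_u f z) x.
Proof.
move=> sf Ux; apply/eqP; rewrite -subr_eq0 -normr_le0; apply/ler_addgt0Pl => e e0.
rewrite addr0.
have e2 : 0 < e / 2 by rewrite divr_gt0.
have HAn := second_difference v u e2 sf Ux.
have HBn := second_difference u v e2 sf Ux.
have [t [[/= HA HB] t0]] := filter_ex (filterI (filterI HAn HBn) (nbhs_right_gt 0)).
set A := 'D_u _ x; set B := 'D_v _ x.
rewrite -/A in HA; rewrite -/B in HB.
rewrite [t *: v + t *: u]addrC in HA.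
have t2 : 0 < t ^+ 2 by rewrite exprn_gt0.
rewrite -(ler_pM2l t2).
have -> : t ^+ 2 * `|A - B| = `|t ^+ 2 * (A - B)| by rewrite normrM (gtr0_norm t2).
set D := f _ in HA HB.
have -> : t ^+ 2 * (A - B) =
    (D - f (t *: u + x) - f (t *: v + x) + f x - t ^+ 2 * B)
    - (D - f (t *: v + x) - f (t *: u + x) + f x - t ^+ 2 * A) by ring.
apply: le_trans (ler_normB _ _) _; apply: le_trans (lerD HB HA) _.
by rewrite -mulrDl -splitr mulrC.
Qed.

End SymmetryOfSecondDerivatives.

(** * Coordinates on TR^n and derivatives along varying fields *)

Section TangentBundleCoordinates.
Context {R : realType} {n : nat}.

Definition tcoord (k : 'I_(n + n)) (v : tpoint R n) : R :=
  match fintype.split k with inl i => v.1 0 i | inr j => v.2 0 j end.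

Lemma tcoord_linear k : linear (tcoord k).
Proof.
by move=> a u v; rewrite /tcoord; case: fintype.split => i /=; rewrite !mxE.
Qed.

HB.instance Definition _ k := GRing.isLinear.Build R (tpoint R n) R *%R
  (tcoord k) (tcoord_linear k).

Lemma tcoord_continuous k : continuous (tcoord k).
Proof.
rewrite /tcoord; case: fintype.split => i z.
- apply: (@continuous_comp _ _ _ fst (fun u : 'rV[R]_n => u 0 i)).
    exact: cvg_fst.
  exact: coord_continuous.
- apply: (@continuous_comp _ _ _ snd (fun u : 'rV[R]_n => u 0 i)).
    exact: cvg_snd.
  exact: coord_continuous.
Qed.

Lemma tbasis_sum (v : tpoint R n) : v = \sum_k tcoord k v *: tbasis R k.
Proof.
have sum_fst k (f : 'I_k -> tpoint R n) : (\sum_i f i).1 = \sum_i (f i).1.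
  exact: (raddf_sum (@fst 'rV[R]_n 'rV[R]_n)).
have sum_snd k (f : 'I_k -> tpoint R n) : (\sum_i f i).2 = \sum_i (f i).2.
  exact: (raddf_sum (@snd 'rV[R]_n 'rV[R]_n)).
rewrite [v in LHS]surjective_pairing [RHS]surjective_pairing sum_fst sum_snd.
rewrite !big_split_ord /=; congr pair.
- rewrite [X in _ = _ + X]big1 ?addr0 => [|i _].
    rewrite {1}[v.1]row_sum_delta; apply: eq_bigr => i _.
    by rewrite /tcoord /tbasis (unsplitK (inl i)).
  by rewrite /tbasis (unsplitK (inr i)) /= scaler0.
- rewrite [X in _ = X + _]big1 ?add0r => [|i _].
    rewrite {1}[v.2]row_sum_delta; apply: eq_bigr => i _.
    by rewrite /tcoord /tbasis (unsplitK (inr i)).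
  by rewrite /tbasis (unsplitK (inl i)) /= scaler0.
Qed.

End TangentBundleCoordinates.

Section DerivativesAlongFields.
Context {R : realType} {n : nat} {U : set (tpoint R n)}.
Hypothesis oU : open U.

Lemma derive_dirD (V W : normedModType R) (f : V -> W) x u v :
  differentiable f x -> 'D_(u + v) f x = 'D_u f x + 'D_v f x.
Proof. by move=> df; rewrite !deriveE// linearD. Qed.

Lemma derive_dirZ (V W : normedModType R) (f : V -> W) x a u :
  differentiable f x -> 'D_(a *: u) f x = a *: 'D_u f x.
Proof. by move=> df; rewrite !deriveE// linearZ. Qed.

Lemma derive_dirN (V W : normedModType R) (f : V -> W) x u :
  differentiable f x -> 'D_(- u) f x = - 'D_u f x.
Proof. by move=> df; rewrite !deriveE// linearN. Qed.

Lemma derive_tbasis (W : normedModType R) (f : tpoint R n -> W) x v :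
  differentiable f x -> 'D_v f x = \sum_k tcoord k v *: 'D_(tbasis R k) f x.
Proof.
move=> df; rewrite deriveE// {1}[v]tbasis_sum linear_sum.
by apply: eq_bigr => k _; rewrite linearZ /= deriveE.
Qed.

(** [Ck] speaks of derivatives along fixed vectors only; expanding the field in the basis reduces to
    these, with the smooth coordinates of [X] as coefficients. *)
Lemma smooth_field (W : normedModType R) (f : tpoint R n -> W)
    (X : tpoint R n -> tpoint R n) :
  smooth_on U f -> smooth_on U X -> smooth_on U (fun z => 'D_(X z) f z).
Proof.
move=> sf sX; apply: (smooth_eq_on oU
  (f := fun z => \sum_k tcoord k (X z) *: 'D_(tbasis R k) f z)) => [z Uz|].
  by rewrite -derive_tbasis//; exact: smooth_differentiable sf Uz.
apply: (smooth_sum oU) => k; apply: (smooth_scale oU).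
  exact: (smooth_lin oU (@tcoord_continuous _ _ k) sX).
exact: smooth_derive.
Qed.

(** The Leibniz rule in the basis expansion: the first term differentiates f with the direction
    frozen at [X x], the second accounts for the motion of [X]. *)
Lemma derive_field (W : normedModType R) (f : tpoint R n -> W)
    (X : tpoint R n -> tpoint R n) x w :
  smooth_on U f -> smooth_on U X -> U x ->
  'D_w (fun z => 'D_(X z) f z) x =
  'D_w (fun z => 'D_(X x) f z) x + 'D_('D_w X x) f x.
Proof.
move=> sf sX Ux.
have df z : U z -> differentiable f z by exact: smooth_differentiable.
have dX : differentiable X x by exact: smooth_differentiable sX Ux.
have dDf k : differentiable (fun z => 'D_(tbasis R k) f z) x.
  exact: smooth_differentiable (smooth_derive _ sf) Ux.
rewrite (derive_eq_on (f := fun z => 'D_(X z) f z)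
  (g := fun z => \sum_k tcoord k (X z) *: 'D_(tbasis R k) f z)
  w oU (fun z Uz => derive_tbasis (X z) (df z Uz)) Ux).
rewrite (derive_eq_on (g := fun z => \sum_k tcoord k (X x) *: 'D_(tbasis R k) f z)
  w oU (fun z Uz => derive_tbasis (X x) (df z Uz)) Ux).
have dL k v := derive_lin v (@tcoord_continuous R n k) dX.
have dS k v := derive_scale v (dL k 0).1 (dDf k).
have sumE (h : 'I_(n + n) -> tpoint R n -> W) :
  (fun z => \sum_k h k z) = \sum_k h k by apply/funext => z; rewrite fct_sumE.
rewrite (sumE (fun k z => tcoord k (X z) *: 'D_(tbasis R k) f z)).
rewrite (sumE (fun k z => tcoord k (X x) *: 'D_(tbasis R k) f z)).
rewrite !derive_sum; last 2 first.
- move=> k; apply: diff_derivable; exact: differentiableZ.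
- move=> k; apply: diff_derivable; exact: (dS k 0).1.
rewrite (derive_tbasis _ (df _ Ux)) -big_split /=; apply: eq_bigr => k _.
rewrite (dS k w).2 (dL k w).2 addrC; congr (_ + _).
by rewrite [RHS]deriveZ//; exact: diff_derivable.
Qed.

End DerivativesAlongFields.

(** * Sprays in a natural chart *)

(** Pointwise counterpart of [vlift], with [vlift W z] convertible to [vert (W z)]: ['D_(vert c)] is
    the fibre derivative along a fixed c. *)
Definition vert {R : realType} {n : nat} (c : 'rV[R]_n) : tpoint R n := (0, c).

Section TangentFields.
Context {R : realType} {n : nat} {U : set (tpoint R n)}.
Hypothesis oU : open U.
Local Notation T := (tpoint R n).
Local Notation E := 'rV[R]_n.

Lemma smooth_fst (V W W' : normedModType R) (D : set V) (X : V -> W * W') :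
  open D -> smooth_on D X -> smooth_on D (fun z => (X z).1).
Proof.
move=> oD sX; apply: (@smooth_lin _ _ _ oD _ _ (@fst W W') _ _ sX) => z.
exact: cvg_fst.
Qed.

Lemma smooth_snd (V W W' : normedModType R) (D : set V) (X : V -> W * W') :
  open D -> smooth_on D X -> smooth_on D (fun z => (X z).2).
Proof.
move=> oD sX; apply: (@smooth_lin _ _ _ oD _ _ (@snd W W') _ _ sX) => z.
exact: cvg_snd.
Qed.

Lemma derive_fst (V W W' : normedModType R) (X : V -> W * W') x v :
  differentiable X x -> ('D_v X x).1 = 'D_v (fun z => (X z).1) x.
Proof.
move=> dX; rewrite (@derive_lin _ _ _ _ (@fst W W') X x v _ dX).2// => z.
exact: cvg_fst.
Qed.

Lemma derive_snd (V W W' : normedModType R) (X : V -> W * W') x v :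
  differentiable X x -> ('D_v X x).2 = 'D_v (fun z => (X z).2) x.
Proof.
move=> dX; rewrite (@derive_lin _ _ _ _ (@snd W W') X x v _ dX).2// => z.
exact: cvg_snd.
Qed.

Lemma smooth_id (V : normedModType R) (D : set V) :
  open D -> smooth_on D (fun z => z).
Proof.
move=> oD [|k] /=; first by move=> x _; exact: cvg_id.
split=> [x _|v]; first exact: ex_diff.
by apply: (Ck_eq_on oD) (smooth_cst oD v k) => z _; rewrite derive_id.
Qed.

Lemma smooth_eta : smooth_on U (@etabar R n).
Proof. exact: smooth_snd oU (smooth_id oU). Qed.

Lemma derive_eta (v x : T) : 'D_v (@etabar R n) x = v.2.
Proof.
rewrite -(derive_snd v (X := fun z => z)) ?derive_id//.
Qed.

Lemma vert0 : vert 0 = 0 :> T. Proof. by []. Qed.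

Lemma vertD (u v : E) : vert (u + v) = vert u + vert v.
Proof. by rewrite [RHS]surjective_pairing /= addr0. Qed.

Lemma vertZ a (u : E) : vert (a *: u) = a *: vert u.
Proof. by rewrite [RHS]surjective_pairing /= scaler0. Qed.

Lemma vertN (u : E) : vert (- u) = - vert u.
Proof. by rewrite -scaleN1r vertZ scaleN1r. Qed.

Lemma vliftE (W : T -> E) z : vlift W z = vert (W z). Proof. by []. Qed.

Lemma smooth_vlift (W : T -> E) : smooth_on U W -> smooth_on U (vlift W).
Proof. by move=> sW; apply: smooth_pair => //; exact: smooth_cst. Qed.

Lemma derive_vlift (W : T -> E) x v :
  differentiable W x -> 'D_v (vlift W) x = vert ('D_v W x).
Proof. by move=> dW; rewrite derive_pair// derive_cst. Qed.

Lemma smooth_vderive (W : normedModType R) (f : T -> W) (X : T -> E) :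
  smooth_on U f -> smooth_on U X -> smooth_on U (fun z => 'D_(vert (X z)) f z).
Proof. by move=> sf sX; apply: (smooth_field oU sf); exact: smooth_vlift. Qed.

Lemma derive_vfield (W : normedModType R) (f : T -> W) (X : T -> E) x w :
  smooth_on U f -> smooth_on U X -> U x ->
  'D_w (fun z => 'D_(vert (X z)) f z) x =
  'D_w (fun z => 'D_(vert (X x)) f z) x + 'D_(vert ('D_w X x)) f x.
Proof.
move=> sf sX Ux; rewrite -(derive_vlift w (smooth_differentiable sX Ux)).
exact: (derive_field oU w sf (smooth_vlift sX)).
Qed.

(** The explicit forms of the projectors and of the horizontal lift hold on [U] only, but [berwald]
    puts them inside brackets, hence under derivatives; openness of [U] allows the replacement
    there. *)
Lemma lie_br_eq_on (X X' Y Y' : T -> T) z :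
  (forall z, U z -> X z = X' z) -> (forall z, U z -> Y z = Y' z) -> U z ->
  lie_br X Y z = lie_br X' Y' z.
Proof.
move=> XX YY Uz; rewrite /lie_br (XX z Uz) (YY z Uz).
by rewrite (derive_eq_on _ oU XX Uz) (derive_eq_on _ oU YY Uz).
Qed.

Lemma vproj_eq_on (G X X' : T -> T) z :
  (forall z, U z -> X z = X' z) -> U z -> vproj G X z = vproj G X' z.
Proof.
move=> XX Uz; have JX y : U y -> Jop X y = Jop X' y.
  by move=> Uy; rewrite /Jop /vlift /rho (XX y Uy).
have l1 := lie_br_eq_on JX (fun y _ => erefl (G y)) Uz.
have l2 := lie_br_eq_on XX (fun y _ => erefl (G y)) Uz.
by rewrite /vproj /barthel (XX z Uz) l1 /Jop /vlift /rho l2.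
Qed.

End TangentFields.

Section Sprays.
Context {R : realType} {n : nat} {U : set (tpoint R n)}.
Hypothesis oU : open U.
Local Notation T := (tpoint R n).
Local Notation E := 'rV[R]_n.
Variable G : T -> T.
Hypothesis sG : smooth_on U G.
Hypothesis G1 : forall z, U z -> (G z).1 = z.2.
Let S z := (G z).2.
Let sS : smooth_on U S := smooth_snd oU sG.

Lemma derive_spray x v : U x -> 'D_v G x = (v.2, 'D_v S x).
Proof.
move=> Ux; have dG := smooth_differentiable sG Ux.
rewrite [LHS]surjective_pairing derive_fst// derive_snd//; congr pair.
by rewrite (derive_eq_on v oU G1 Ux); exact: derive_eta.
Qed.

(** The derivative of the base component of [X] along [G] occurs in both brackets and cancels. So
    Gamma depends on the value of [X] at z alone, and the projectors and the horizontal lift become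
    algebraic. *)
Lemma barthelE (X : T -> T) z : U z -> differentiable X z ->
  barthel G X z = ((X z).1, 'D_(vert (X z).1) S z - (X z).2).
Proof.
move=> Uz dX; have dX1 : differentiable (fun z => (X z).1) z.
  by apply: (differentiable_comp dX); apply: linear_differentiable => ?; exact: cvg_fst.
rewrite /barthel /lie_br /Jop /vlift /rho (derive_vlift _ dX1) /=.
rewrite !derive_spray// derive_fst//.
rewrite [LHS]surjective_pairing /=; congr pair.
  by rewrite subr0 subr0.
by rewrite opprB addrA subrK.
Qed.

Lemma half_add (a : E) : 2^-1 *: (a + a) = a.
Proof.
rewrite scalerDr -scalerDl; have -> : 2^-1 + 2^-1 = 1 :> R by field.
exact: scale1r.
Qed.

Lemma hprojE (X : T -> T) z : U z -> differentiable X z ->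
  hproj G X z = ((X z).1, 2^-1 *: 'D_(vert (X z).1) S z).
Proof.
move=> Uz dX; rewrite /hproj barthelE//.
rewrite [LHS]surjective_pairing /=; congr pair.
  exact: half_add.
by rewrite addrC subrK.
Qed.

Lemma vprojE (X : T -> T) z : U z -> differentiable X z ->
  vproj G X z = (0, (X z).2 - 2^-1 *: 'D_(vert (X z).1) S z).
Proof.
move=> Uz dX; rewrite /vproj barthelE//.
rewrite [LHS]surjective_pairing /=; congr pair.
  by rewrite subrr scaler0.
by rewrite opprB addrA scalerBr half_add.
Qed.

(** An element of Im h is determined by its base component, so the choice made by [xget] is forced.
    For existence the constant field [(W z, 0)] is projected, which asks no regularity of [W]. *)
Lemma hmapE (W : T -> E) z : U z ->
  hmap G W z = (W z, 2^-1 *: 'D_(vert (W z)) S z).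
Proof.
move=> Uz.
have hE u : hspace G z u -> u = (u.1, 2^-1 *: 'D_(vert u.1) S z).
  by move=> [X dX <-]; rewrite hprojE.
have : exists u, hspace G z u /\ u.1 = W z.
  exists (W z, 2^-1 *: 'D_(vert (W z)) S z); split=> //.
  exists (cst (W z, 0)); first exact: differentiable_cst.
  by rewrite hprojE//; exact: differentiable_cst.
by move=> /(xgetPex 0) => -[/hE hmE hm1]; rewrite -hm1.
Qed.

Lemma smooth_hmap (W : T -> E) : smooth_on U W -> smooth_on U (hmap G W).
Proof.
move=> sW; apply: (smooth_eq_on oU (f := fun z => (W z, 2^-1 *: 'D_(vert (W z)) S z))).
  by move=> z Uz; rewrite hmapE.
apply: smooth_pair => //; apply: smooth_scale => //; first exact: smooth_cst.
exact: smooth_vderive.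
Qed.

Lemma rho_lie_br_hmap (W Z : T -> E) z :
  smooth_on U W -> smooth_on U Z -> U z ->
  rho (lie_br (vlift W) (hmap G Z)) z = 'D_(vert (W z)) Z z.
Proof.
move=> sW sZ Uz; rewrite /rho /lie_br /=.
rewrite derive_vlift; last exact: smooth_differentiable sW Uz.
rewrite derive_fst; last exact: smooth_differentiable (smooth_hmap sZ) Uz.
rewrite subr0; apply: (derive_eq_on _ oU) => // y Uy.
by rewrite hmapE.
Qed.

(** A vertical field has no horizontal part, so the first summand of [berwald] vanishes; in the
    second, the bracket with the lift of [Z] has base component d_W Z. *)
Lemma berwald_vlift (W Z : T -> E) z :
  smooth_on U W -> smooth_on U Z -> U z ->
  berwald G (vlift W) Z z = 'D_(vert (W z)) Z z.
Proof.
move=> sW sZ Uz; rewrite /berwald.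
have sv := smooth_vlift oU sW.
have h0 y : U y -> hproj G (vlift W) y = 0.
  move=> Uy; rewrite hprojE//; last exact: smooth_differentiable sv Uy.
  by rewrite /= vert0 derive0 scaler0.
have l0 y : U y -> lie_br (hproj G (vlift W)) (vlift Z) y = 0.
  move=> Uy; rewrite (lie_br_eq_on oU h0 (fun _ _ => erefl) Uy).
  by rewrite /lie_br derive0 derive_cst subr0.
rewrite (vproj_eq_on oU (X' := cst 0) G l0 Uz) vprojE//.
rewrite /= vert0 derive0 scaler0 subr0 add0r.
have v1 y : U y -> vproj G (vlift W) y = vlift W y.
  move=> Uy; rewrite vprojE//; last exact: smooth_differentiable sv Uy.
  by rewrite /= vert0 derive0 scaler0 subr0.
rewrite -(rho_lie_br_hmap sW sZ Uz) /rho.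
by rewrite (lie_br_eq_on oU v1 (fun _ _ => erefl) Uz).
Qed.

(** The bracket of beta W with gamma Z is [B], whose base component is - d_Z W. The vertical
    projection turns this component into half of the derivative of S along d_Z W, which cancels the
    derivative of [W] inside d_Z (d_W S). Hence [W] stands frozen at z in the result. *)
Lemma berwald_hmap (W Z : T -> E) z :
  smooth_on U W -> smooth_on U Z -> U z ->
  berwald G (hmap G W) Z z =
  'D_(hmap G W z) Z z - 2^-1 *: 'D_(vert (Z z)) (fun y => 'D_(vert (W z)) S y) z.
Proof.
move=> sW sZ Uz; rewrite /berwald.
have sh := smooth_hmap sW.
have h1 y : U y -> hproj G (hmap G W) y = hmap G W y.
  move=> Uy; rewrite hprojE//; last exact: smooth_differentiable sh Uy.
  by rewrite hmapE.
have v0 y : U y -> vproj G (hmap G W) y = 0.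
  move=> Uy; rewrite vprojE//; last exact: smooth_differentiable sh Uy.
  by rewrite hmapE// subrr.
rewrite /rho (lie_br_eq_on oU v0 (fun _ _ => erefl) Uz).
rewrite {2}/lie_br derive0 derive_cst subr0 addr0.
pose B y := (- 'D_(vert (Z y)) W y, 'D_(hmap G W y) Z y
  - 2^-1 *: 'D_(vert (Z y)) (fun y => 'D_(vert (W y)) S y) y).
have sD : smooth_on U (fun y => 'D_(vert (W y)) S y) by exact: smooth_vderive.
have lB y : U y -> lie_br (hproj G (hmap G W)) (vlift Z) y = B y.
  move=> Uy; rewrite (lie_br_eq_on oU h1 (fun _ _ => erefl) Uy) /lie_br.
  rewrite derive_vlift; last exact: smooth_differentiable sZ Uy.
  rewrite (derive_eq_on (f := hmap G W)
    (g := fun z => (W z, 2^-1 *: 'D_(vert (W z)) S z)) _ oU (hmapE W) Uy).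
  rewrite derive_pair; last 2 first.
  - exact: smooth_differentiable sW Uy.
  - exact: differentiableZ (smooth_differentiable sD Uy).
  have DZ : 'D_(vert (Z y)) (fun y => 2^-1 *: 'D_(vert (W y)) S y) y =
      2^-1 *: 'D_(vert (Z y)) (fun y => 'D_(vert (W y)) S y) y.
    by apply: deriveZ; apply: diff_derivable; exact: smooth_differentiable sD Uy.
  rewrite /vlift DZ.
  by rewrite /B [LHS]surjective_pairing /= sub0r.
have sB : smooth_on U B.
  apply: (smooth_pair oU); first by apply: (smoothN oU); exact: smooth_vderive.
  apply: (smoothB oU); first exact: smooth_field.
  apply: (smooth_scale oU); first exact: smooth_cst.
  exact: smooth_vderive.
have dB := smooth_differentiable sB Uz.
rewrite (vproj_eq_on oU G lB Uz).
rewrite (vprojE Uz dB).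
rewrite [LHS]/=.
rewrite -addrA; congr (_ + _).
set r := 'D_(vert ('D_(vert (Z z)) W z)) S z.
have -> : 'D_(vert (- 'D_(vert (Z z)) W z)) S z = - r.
  by rewrite vertN -scaleN1r (derive_dirZ _ _ (smooth_differentiable sS Uz)) scaleN1r.
have half_cancel (a b c : E) :
    a = b + c -> - (2^-1 *: a) - 2^-1 *: - c = - (2^-1 *: b).
  by move=> ->; rewrite scalerDr scalerN opprK opprD subrK.
apply: half_cancel; exact: derive_vfield (vert (Z z)) sS sW Uz.
Qed.

End Sprays.

(** * Euler's relation and the fibre Hessian *)

Section SecondOrderForms.
Context {R : realType} {n : nat} {U : set (tpoint R n)}.
Hypothesis oU : open U.
Local Notation T := (tpoint R n).
Local Notation E := 'rV[R]_n.

Lemma homogeneous_euler (f : T -> R) k :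
  smooth_on U f ->
  (forall z (t : R), U z -> 0 < t -> f (z.1, t *: z.2) = t ^+ k * f z) ->
  forall z, U z -> 'D_(vert z.2) f z = k%:R * f z.
Proof.
move=> sf fh z Uz.
have df := smooth_differentiable sf Uz.
have z0 : 0 *: vert z.2 + z = z by rewrite scale0r add0r.
have [_] : is_derive (0 : R) 1 (fun s : R => f (s *: vert z.2 + z))
    ('D_(vert z.2) f (0 *: vert z.2 + z)).
  by apply: is_derive_line; rewrite z0; exact: diff_derivable.
rewrite z0 => <-.
(* Along the line through z the fibre coordinate is (s + 1) y, and homogeneity applies as long as s
   + 1 is positive. *)
have op : open [set s : R | -1 < s] by exact: open_gt.
rewrite (derive_eq_on (g := fun s : R => (s + 1) ^+ k * f z) _ op); last 2 first.
- move=> s s1; rewrite -fh//; last by move: s1 => /=; lra.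
  congr f; rewrite [LHS]surjective_pairing /=; congr pair.
    by rewrite scaler0 add0r.
  by rewrite scalerDl scale1r.
- by rewrite /= oppr_lt0.
have dp : is_derive (0 : R) 1 (fun s : R => s + 1) 1.
  have -> : (fun s : R => s + 1) = id + cst 1 by [].
  by rewrite -[X in is_derive _ _ _ X]addr0; exact: is_deriveD.
have dpk : is_derive (0 : R) 1 (fun s : R => (s + 1) ^+ k) k%:R.
  have -> : (fun s : R => (s + 1) ^+ k) = (fun s => s + 1) ^+ k.
    by rewrite exprfctE.
  apply: is_derive_eq; rewrite /= add0r expr1n.
  by rewrite mulr1 [LHS]mulr1.
rewrite (derive_mul _ _ (differentiable_cst _ _)).2; last first.
  apply/derivable1_diffP; exact: ex_derive.
by rewrite derive_cst mulr0 addr0 derive_val.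
Qed.

Lemma dJE (f : T -> R) (X : T -> T) z : dJ f X z = 'D_(vert (X z).1) f z.
Proof. by []. Qed.

(** d_J f vanishes on vertical fields, which leaves two terms of dd_J; the bracket term cancels the
    derivative of [Y], and the fibre Hessian of f remains. *)
Lemma ddJ_vlift (f : T -> R) (X : T -> E) (Y : T -> T) z :
  smooth_on U f -> smooth_on U X -> smooth_on U Y -> U z ->
  ddJ f (vlift X) Y z = 'D_(vert (X z)) (fun y => 'D_(vert (Y z).1) f y) z.
Proof.
move=> sf sX sY Uz.
have dX := smooth_differentiable (smooth_vlift oU sX) Uz.
have dY := smooth_differentiable sY Uz.
have e1 : ('D_(Y z) (vlift X) z).1 = 0.
  by rewrite (derive_fst _ dX); exact: derive_cst.
have fstB (a b : T) : (a - b).1 = a.1 - b.1 by [].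
have brE : (lie_br (vlift X) Y z).1 = 'D_(vert (X z)) (fun z => (Y z).1) z.
  rewrite /lie_br fstB -[RHS]subr0; congr (_ - _); last exact: e1.
  exact: derive_fst.
have J0 : dJ f (vlift X) = cst 0.
  by apply/funext => y; rewrite dJE vliftE vert0 derive0.
rewrite /ddJ J0 /dact derive_cst subr0 dJE brE vliftE.
have sY1 := smooth_fst oU sY.
apply/eqP; rewrite subr_eq; apply/eqP.
exact: (derive_vfield oU (vert (X z)) sf sY1 Uz).
Qed.

Lemma fmetricE (f : T -> R) (X Y : T -> E) z :
  smooth_on U f -> smooth_on U X -> smooth_on U Y -> U z ->
  fmetric f X Y z = 'D_(vert (X z)) (fun y => 'D_(vert (Y z)) f y) z.
Proof.
move=> sf sX sY Uz; apply: ddJ_vlift => //.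
by apply: (smooth_pair oU) => //; exact: (smooth_cst oU).
Qed.

(** Full rank of the 2-form on TTM passes to the fibre Hessian: the row (0, v) represents the
    vertical vector of v, and its product with the matrix has the entries d_v d_c f, c being the
    base part of a basis vector. *)
Lemma ddJ_nondegenerate (f : T -> R) z v :
  smooth_on U f -> U z -> ddJ_max_rank f z ->
  (forall c, 'D_(vert v) (fun y => 'D_(vert c) f y) z = 0) -> v = 0.
Proof.
move=> sf Uz rk v0.
move: rk; rewrite /ddJ_max_rank; set Q := (\matrix_(_, _) _) => rk.
suff : row_mx 0 v *m Q = 0.
  move=> /eqP; rewrite mulmx_free_eq0; last by apply/eqP.
  by rewrite row_mx_eq0 => /andP[_ /eqP].
apply/rowP => l; rewrite !mxE big_split_ord /=.
rewrite big1 ?add0r => [|i _]; last by rewrite row_mxEl mxE mul0r.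
set c := (tbasis R l).1.
have dc : differentiable (fun y => 'D_(vert c) f y) z.
  exact: smooth_differentiable (smooth_derive _ sf) Uz.
rewrite -[RHS](v0 c) (derive_tbasis _ dc) big_split_ord /=.
rewrite [X in X + _]big1 ?add0r => [|i _]; last first.
  by rewrite /tcoord (unsplitK (inl i)) mxE scale0r.
apply: eq_bigr => j _.
have tb : tbasis R (rshift n j) = vert (delta_mx 0 j).
  by rewrite /tbasis (unsplitK (inr j)).
rewrite /tcoord row_mxEr (unsplitK (inr j)) mxE tb.
by rewrite (ddJ_vlift sf (smooth_cst oU _) (smooth_cst oU _) Uz).
Qed.

End SecondOrderForms.

(** * The spray equation and conservation of energy *)

Section SprayEquation.
Context {R : realType} {n : nat} {U : set (tpoint R n)}.
Hypothesis oU : open U.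
Local Notation T := (tpoint R n).
Variables (G : T -> T) (f : T -> R).
Hypotheses (sG : smooth_on U G) (G1 : forall z, U z -> (G z).1 = z.2).
Hypotheses (sf : smooth_on U f)
  (f_euler : forall z, U z -> 'D_(vert z.2) f z = 2 * f z).
Let S z := (G z).2.
Let sS : smooth_on U S := smooth_snd oU sG.

(** Euler's relation differentiated along v; the direction y moves as well, whence the subtracted
    term. For vertical v only one of the two copies of d_v f survives. *)
Lemma derive_euler z v : U z ->
  'D_v (fun y => 'D_(vert z.2) f y) z = 2 * 'D_v f z - 'D_(vert v.2) f z.
Proof.
move=> Uz; have df := smooth_differentiable sf Uz.
have D2 : 'D_v (fun y => 2 * f y) z = 2 * 'D_v f z.
  rewrite (derive_mul _ (differentiable_cst _ _) df).2 derive_cst mul0r.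
  exact: add0r.
have D1 : 'D_v (fun y => 'D_(vert (etabar y)) f y) z = 2 * 'D_v f z.
  by rewrite -D2; exact: (derive_eq_on _ oU f_euler Uz).
have D3 := derive_vfield oU v sf (smooth_eta oU) Uz.
rewrite derive_eta in D3.
by apply/eqP; rewrite eq_sym subr_eq -D1; apply/eqP; exact: D3.
Qed.

Hypothesis G_eq : forall z c, U z ->
  ddJ f G (cst (c, 0)) z = - dact (cst (c, 0)) f z.

(** These are the Euler-Lagrange equations. d_J f(G) is 2 f by Euler's relation, and the bracket of
    [G] with the constant field (c, 0) is vertical, so d_J f kills it. *)
Lemma spray_equation z c : U z ->
  'D_(G z) (fun y => 'D_(vert c) f y) z = 'D_(c, 0) f z.
Proof.
move=> Uz; have := G_eq c Uz.
have df := smooth_differentiable sf Uz.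
have D2 : 'D_(c, 0) (fun y => 2 * f y) z = 2 * 'D_(c, 0) f z.
  rewrite (derive_mul _ (differentiable_cst _ _) df).2 derive_cst mul0r.
  exact: add0r.
have D1 : 'D_(c, 0) (dJ f G) z = 2 * 'D_(c, 0) f z.
  rewrite -D2; apply: (derive_eq_on _ oU) Uz => y Uy.
  by rewrite dJE G1// f_euler.
have br0 : (lie_br G (cst (c, 0)) z).1 = 0.
  by rewrite /lie_br derive_cst sub0r (derive_spray oU sG G1 _ Uz) /= oppr0.
have D0 : dJ f (lie_br G (cst (c, 0))) z = 0 by rewrite dJE br0 vert0 derive0.
have lin (a b d e : R) : d = 2 * b -> e = 0 -> a - d - e = - b -> a = b.
  by move=> -> -> /eqP; rewrite subr0 subr_eq => /eqP ->; ring.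
exact: lin D1 D0.
Qed.

(** Euler's relation differentiated along [G], combined with the spray equation for c = y, gives G.f
    = 2 G.f. *)
Lemma spray_energy z : U z -> 'D_(G z) f z = 0.
Proof.
move=> Uz; have := derive_euler (G z) Uz; rewrite spray_equation//.
have df := smooth_differentiable sf Uz.
have GE : G z = (z.2, 0) + vert (G z).2.
  by rewrite [LHS]surjective_pairing [RHS]surjective_pairing /= addr0 add0r G1.
have GfE : 'D_(G z) f z = 'D_(z.2, 0) f z + 'D_(vert (G z).2) f z.
  by rewrite {1}GE derive_dirD.
have lin (x s d : R) : x = 2 * d - s -> d = x + s -> d = 0.
  move=> ->; rewrite subrK mulr_natl mulr2n => /esym/eqP.
  by rewrite -subr_eq0 addrK => /eqP.
by move=> xE; exact: lin xE GfE.
Qed.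

(** The way horizontal lifts enter: (c, 0) stems from the spray equation, and (c, d_c S) is the
    derivative of [G] along gamma(c). *)
Lemma hmap_double z c : U z ->
  (c, 0) + (c, 'D_(vert c) S z) = 2 *: hmap G (cst c) z.
Proof.
move=> Uz; rewrite (hmapE oU sG G1 _ Uz).
rewrite [LHS]surjective_pairing [RHS]surjective_pairing /=.
by rewrite add0r scalerA divff ?pnatr_eq0// scale1r scaler_nat mulr2n.
Qed.

Lemma derive_along_spray (h : T -> R) z c : smooth_on U h -> U z ->
  'D_(vert c) (fun y => 'D_(G y) h y) z =
  'D_(G z) (fun y => 'D_(vert c) h y) z + 'D_(c, 'D_(vert c) S z) h z.
Proof.
move=> sh Uz; rewrite (derive_field oU _ sh sG Uz) (derive_spray oU sG G1 _ Uz) /=.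
by rewrite (derive_sym oU _ _ sh Uz).
Qed.

Lemma horizontal_energy z c : U z -> 'D_(hmap G (cst c) z) f z = 0.
Proof.
move=> Uz; have df := smooth_differentiable sf Uz.
have := derive_along_spray c sf Uz; rewrite spray_equation//.
rewrite (derive_eq_on _ oU spray_energy Uz) derive_cst -derive_dirD//.
rewrite hmap_double// derive_dirZ// => /esym/eqP.
by rewrite scaler_eq0 pnatr_eq0/= => /eqP.
Qed.

End SprayEquation.

(** * Explicit derivatives of rational expressions *)

Section Derivations.
Context {R : realType} {V : normedModType R}.

(** Differentiability and value are bundled so that the derivative of a rational expression is
    assembled along its syntax, and [field] can then simplify it. *)
Definition has_derivative (f : V -> R) x v d :=
  differentiable f x /\ 'D_v f x = d.

Lemma has_derivativeP (f : V -> R) x v :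
  differentiable f x -> has_derivative f x v ('D_v f x).
Proof. by []. Qed.

Lemma has_derivative_cst a x v : has_derivative (fun=> a) x v 0.
Proof. by split; [exact: differentiable_cst|exact: derive_cst]. Qed.

Lemma has_derivativeD (f g : V -> R) x v d e :
  has_derivative f x v d -> has_derivative g x v e ->
  has_derivative (fun z => f z + g z) x v (d + e).
Proof.
move=> [df <-] [dg <-]; split; first exact: differentiableD.
by apply: deriveD; exact: diff_derivable.
Qed.

Lemma has_derivativeB (f g : V -> R) x v d e :
  has_derivative f x v d -> has_derivative g x v e ->
  has_derivative (fun z => f z - g z) x v (d - e).
Proof.
move=> [df <-] [dg <-]; split; first exact: differentiableB.
by apply: deriveB; exact: diff_derivable.
Qed.

Lemma has_derivativeM (f g : V -> R) x v d e :
  has_derivative f x v d -> has_derivative g x v e ->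
  has_derivative (fun z => f z * g z) x v (d * g x + f x * e).
Proof. by move=> [df <-] [dg <-]; exact: derive_mul. Qed.

Lemma has_derivativeV (f : V -> R) x v d : f x != 0 ->
  has_derivative f x v d ->
  has_derivative (fun z => (f z)^-1) x v (- (f x)^-1 * (f x)^-1 * d).
Proof.
move=> f0 [df <-]; split; first exact: differentiableV.
exact: derive_inv.
Qed.

Lemma has_derivativeX (f : V -> R) k x v d :
  has_derivative f x v d ->
  has_derivative (fun z => f z ^+ k.+1) x v (k.+1%:R * f x ^+ k * d).
Proof.
move=> fd; elim: k => [|k IH].
  have -> : (fun z => f z ^+ 1) = f by apply/funext => z; rewrite expr1.
  by rewrite expr0 !mul1r.
have -> : (fun z => f z ^+ k.+2) = fun z => f z * f z ^+ k.+1.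
  by apply/funext => z; rewrite exprS.
have [dM DM] := has_derivativeM fd IH; split=> //.
by rewrite DM -[k.+2%:R]natr1 !exprS; ring.
Qed.

End Derivations.

(** * Concurrent fields *)

Section ConcurrentFields.
Context {R : realType} {n : nat} {U : set (tpoint R n)}.
Hypothesis oU : open U.
Local Notation T := (tpoint R n).
Local Notation E := 'rV[R]_n.
Variables (G : T -> T) (f : T -> R) (phi : T -> E).
Hypotheses (sG : smooth_on U G) (G1 : forall z, U z -> (G z).1 = z.2).
Hypotheses (sf : smooth_on U f)
  (f_euler : forall z, U z -> 'D_(vert z.2) f z = 2 * f z).
Hypothesis G_eq : forall z c, U z ->
  ddJ f G (cst (c, 0)) z = - dact (cst (c, 0)) f z.
(* The conditions D_(gamma c) phi = 0 and D_(beta c) phi = - c on the Berwald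
   connection, and nabla_(gamma c) phi = 0 on the Cartan connection; given the
   first, the third says that the Cartan tensor annihilates phi. *)
Hypotheses (sphi : smooth_on U phi)
  (phi_basic : forall z c, U z -> 'D_(vert c) phi z = 0)
  (phi_horizontal : forall z c, U z -> 'D_(hmap G (cst c) z) phi z
     - 2^-1 *: 'D_(vert (phi z)) (fun y => 'D_(vert c) (fun x => (G x).2) y) z
     = - c)
  (phi_cartan : forall z c d, U z ->
     'D_(vert c) (fun y => 'D_(vert (phi y)) (fun x => 'D_(vert d) f x) y) z = 0).

(** This is Phi: for a 2-homogeneous f, Euler's relation gives g(phi, eta) = d_phi f, an expression
    with one derivative less. *)
Definition phi_form z := 'D_(vert (phi z)) f z.
Local Notation Phi := phi_form.

Lemma smooth_phi_form : smooth_on U Phi.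
Proof. exact: smooth_vderive. Qed.

(** As phi does not depend on y, the derivative falls on f alone. The right-hand side is g(phi,
    c). *)
Lemma phi_form_vert z c : U z ->
  'D_(vert c) Phi z = 'D_(vert (phi z)) (fun y => 'D_(vert c) f y) z.
Proof.
move=> Uz; rewrite [LHS](derive_vfield oU _ sf sphi Uz) phi_basic// vert0 derive0.
by rewrite addr0 (derive_sym oU).
Qed.

Lemma phi_form_vert2 z c d : U z ->
  'D_(vert c) (fun y => 'D_(vert d) Phi y) z = 0.
Proof.
move=> Uz; rewrite -(phi_cartan c d Uz); apply: (derive_eq_on _ oU) Uz => y Uy.
exact: phi_form_vert.
Qed.

Lemma phi_form_eta z : U z -> 'D_(vert z.2) Phi z = Phi z.
Proof.
move=> Uz; rewrite phi_form_vert// (derive_euler oU sf f_euler _ Uz) /=.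
by rewrite /phi_form; lra.
Qed.

(** Since (beta c).f = 0, moving beta c past d_phi costs only the derivative of beta c along phi,
    which is (1/2) d_phi d_c S, vertical. What is left is the derivative of f along (beta c).phi -
    (1/2) d_phi d_c S, the Berwald derivative of phi, equal to - c. *)
Lemma phi_form_horizontal z c : U z ->
  'D_(hmap G (cst c) z) Phi z = - 'D_(vert c) f z.
Proof.
move=> Uz; have df := smooth_differentiable sf Uz.
have sc : smooth_on U (cst c : T -> E) by exact: smooth_cst.
have sS := smooth_snd oU sG.
have sD : smooth_on U (fun y => 'D_(vert c) (fun x => (G x).2) y).
  exact: smooth_derive.
rewrite [LHS](derive_vfield oU _ sf sphi Uz) (derive_sym oU _ _ sf Uz).
have D0 : 'D_(vert (phi z)) (fun y => 'D_(hmap G (cst c) y) f y) z = 0.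
  rewrite -(derive_cst (0 : R) z (vert (phi z))); apply: (derive_eq_on _ oU) Uz.
  by move=> y Uy; exact: (horizontal_energy oU sG G1 sf f_euler G_eq).
have Dh : 'D_(vert (phi z)) (hmap G (cst c)) z = vert
    (2^-1 *: 'D_(vert (phi z)) (fun y => 'D_(vert c) (fun x => (G x).2) y) z).
  rewrite (derive_eq_on _ oU (hmapE oU sG G1 (cst c)) Uz).
  have dD := smooth_differentiable sD Uz.
  rewrite (derive_pair _ (differentiable_cst _ _) (differentiableZ _ dD)).
  by rewrite derive_cst deriveZ//; exact: diff_derivable.
have D1 := derive_field oU (vert (phi z)) sf (smooth_hmap oU sG G1 sc) Uz.
have D2 := etrans (esym D0) (etrans D1 (congr1 (fun v => _ + 'D_v f z) Dh)).
have cancel (a b d e : R) : 0 = a + b -> d - b = e -> a + d = e.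
  by move=> /esym/eqP; rewrite addr_eq0 => /eqP -> <-; rewrite addrC.
apply: cancel D2 _.
have dirB (a b : E) : 'D_(vert a) f z - 'D_(vert b) f z = 'D_(vert (a - b)) f z.
  by rewrite vertD vertN (derive_dirD _ _ df) (derive_dirN _ df).
apply: etrans (dirB _ _) _; rewrite phi_horizontal//.
by rewrite vertN derive_dirN.
Qed.

End ConcurrentFields.

(** * The spray of the Matsumoto metric *)

Section MatsumotoEnergy.
Context {R : realType} {V : normedModType R}.
Variables (F Phi : V -> R) (x v : V) (dF dPhi : R).
Hypotheses (hF : has_derivative F x v dF) (hPhi : has_derivative Phi x v dPhi).
Hypothesis t0 : F x - Phi x != 0.

(* The partial derivatives of the energy e = F^4 / (2 (F - Phi)^2) *)
Definition matsumoto_dF (F Phi : V -> R) z :=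
  F z ^+ 3 * (F z - 2 * Phi z) * ((F z - Phi z) ^+ 3)^-1.
Definition matsumoto_dPhi (F Phi : V -> R) z :=
  F z ^+ 4 * ((F z - Phi z) ^+ 3)^-1.

Let t3 : (F x - Phi x) ^+ 3 != 0. Proof. by rewrite expf_neq0. Qed.

Lemma derive_energy : 'D_v (fun z => 2^-1 * F z ^+ 2) x = F x * dF.
Proof.
have [_ ->] := has_derivativeM (has_derivative_cst 2^-1 x v) (has_derivativeX 1 hF).
by field.
Qed.

Lemma derive_matsumoto_energy :
  'D_v (fun z => 2^-1 * (F z ^+ 2 / (F z - Phi z)) ^+ 2) x =
  matsumoto_dF F Phi x * dF + matsumoto_dPhi F Phi x * dPhi.
Proof.
have [_ ->] := has_derivativeM (has_derivative_cst 2^-1 x v) (has_derivativeX 1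
  (has_derivativeM (has_derivativeX 1 hF)
     (has_derivativeV (f := fun z => F z - Phi z) t0 (has_derivativeB hF hPhi)))).
by rewrite /matsumoto_dF /matsumoto_dPhi; field.
Qed.

(** The coefficients are the second partial derivatives of e; the mixed one returns in
    [derive_matsumoto_dPhi]. *)
Lemma derive_matsumoto_dF : 'D_v (matsumoto_dF F Phi) x =
  F x ^+ 2 * (F x ^+ 2 - 4 * F x * Phi x + 6 * Phi x ^+ 2)
    / (F x - Phi x) ^+ 4 * dF +
  F x ^+ 3 * (F x - 4 * Phi x) / (F x - Phi x) ^+ 4 * dPhi.
Proof.
have [_ ->] := has_derivativeM (has_derivativeM (has_derivativeX 2 hF)
  (has_derivativeB hF (has_derivativeM (has_derivative_cst 2 x v) hPhi)))
  (has_derivativeV (f := fun z => (F z - Phi z) ^+ 3) t3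
    (has_derivativeX 2 (has_derivativeB hF hPhi))).
by field.
Qed.

Lemma derive_matsumoto_dPhi : 'D_v (matsumoto_dPhi F Phi) x =
  F x ^+ 3 * (F x - 4 * Phi x) / (F x - Phi x) ^+ 4 * dF +
  3 * F x ^+ 4 / (F x - Phi x) ^+ 4 * dPhi.
Proof.
have [_ ->] := has_derivativeM (has_derivativeX 3 hF)
  (has_derivativeV (f := fun z => (F z - Phi z) ^+ 3) t3
    (has_derivativeX 2 (has_derivativeB hF hPhi))).
by field.
Qed.

End MatsumotoEnergy.

(* Here u = d_c F, w = d_c Phi, dF = d_P F and dFu = d_P d_c F for
   P = a eta + b phi; the conclusion is d_P d_c Ehat = F^2 d_c (de/dPhi). *)
Lemma matsumoto_spray_identity (R : realType) (F Phi p2 u w dF dFu a b : R) :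
  F != 0 -> F - Phi != 0 -> F * (1 + 2 * p2) - 3 * Phi != 0 ->
  a = - (F * (4 * Phi - F) / (F * (1 + 2 * p2) - 3 * Phi)) ->
  b = 2 * F ^+ 3 / (F * (1 + 2 * p2) - 3 * Phi) ->
  F * dF = a * F ^+ 2 + b * Phi ->
  F * dFu + dF * u = a * (F * u) + b * w ->
  let dPhi := a * Phi + b * p2 in
  (F ^+ 2 * (F ^+ 2 - 4 * F * Phi + 6 * Phi ^+ 2) / (F - Phi) ^+ 4 * dF +
   F ^+ 3 * (F - 4 * Phi) / (F - Phi) ^+ 4 * dPhi) * u +
  F ^+ 3 * (F - 2 * Phi) * ((F - Phi) ^+ 3)^-1 * dFu +
  (F ^+ 3 * (F - 4 * Phi) / (F - Phi) ^+ 4 * dF +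
   3 * F ^+ 4 / (F - Phi) ^+ 4 * dPhi) * w =
  F ^+ 2 * (F ^+ 3 * (F - 4 * Phi) / (F - Phi) ^+ 4 * u +
   3 * F ^+ 4 / (F - Phi) ^+ 4 * w).
Proof.
move=> F0 t0 Q0 aE bE dFE dFuE.
(* The two equations are d_P E and d_P d_c E written with E = F^2 / 2. Solved for [dF] and [dFu],
   they leave a rational identity with denominators F, F - Phi and F (1 + 2 p^2) - 3 Phi. *)
have {}dFE : dF = (a * F ^+ 2 + b * Phi) / F by rewrite -dFE; field.
have {}dFuE : dFu = (a * (F * u) + b * w - dF * u) / F.
  by rewrite -dFuE; field.
rewrite /= dFuE dFE aE bE; field.
by rewrite F0 t0 Q0.
Qed.

(** A, B and X are the derivatives of d_c Ehat along Ghat, G and gamma(P); D and K those of Ehat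
    along (c, 0) and (c, d_c S); L is d_c (G.Ehat) and M is (beta c).Ehat; q is de/dPhi, p is d_c q
    and l is d_c F. Then X = 2 M - L, where the terms in q cancel. *)
Lemma spray_difference_arith (R : realType) (A B D K L M X p F q l : R) :
  A = D -> L = B + K -> L = - (p * F ^+ 2 + 2 * q * F * l) -> D + K = 2 * M ->
  A = B + X -> M = - (q * (F * l)) -> X = F ^+ 2 * p.
Proof.
move=> AD LBK LE DK AX ME.
have -> : X = D + K - L by rewrite LBK -AD AX; ring.
by rewrite DK LE ME; ring.
Qed.

Section MatsumotoSpray.
Context {R : realType} {n : nat} {U : set (tpoint R n)}.
Hypothesis oU : open U.
Local Notation T := (tpoint R n).
Local Notation E := 'rV[R]_n.
Variables (G Ghat : T -> T) (F Phi p2 : T -> R) (phi : T -> E).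
Local Notation Ehat := (fun z => 2^-1 * (F z ^+ 2 / (F z - Phi z)) ^+ 2).
Hypotheses (sG : smooth_on U G) (G1 : forall z, U z -> (G z).1 = z.2)
  (G_hom : forall z, U z -> 'D_(vert z.2) (fun y => (G y).2) z = 2 *: (G z).2)
  (G_eq : forall z c, U z ->
    ddJ (energy F) G (cst (c, 0)) z = - dact (cst (c, 0)) (energy F) z).
Hypotheses (sF : smooth_on U F) (F0 : forall z, U z -> F z != 0)
  (E_euler : forall z, U z -> 'D_(vert z.2) (energy F) z = 2 * energy F z).
Hypotheses (sPhi : smooth_on U Phi)
  (t0 : forall z, U z -> F z - Phi z != 0)
  (Q0 : forall z, U z -> F z * (1 + 2 * p2 z) - 3 * Phi z != 0)
  (PhiE : forall z, U z -> Phi z = 'D_(vert (phi z)) (energy F) z)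
  (p2E : forall z, U z -> p2 z = 'D_(vert (phi z)) Phi z)
  (Phi_vert : forall z c, U z -> 'D_(vert c) Phi z =
     'D_(vert (phi z)) (fun y => 'D_(vert c) (energy F) y) z)
  (Phi_vert2 : forall z c d, U z ->
     'D_(vert c) (fun y => 'D_(vert d) Phi y) z = 0)
  (Phi_euler : forall z, U z -> 'D_(vert z.2) Phi z = Phi z)
  (Phi_horizontal : forall z c, U z ->
     'D_(hmap G (cst c) z) Phi z = - 'D_(vert c) (energy F) z).
Hypotheses (sGhat : smooth_on U Ghat)
  (Ghat1 : forall z, U z -> (Ghat z).1 = z.2)
  (Ehat_euler : forall z, U z -> 'D_(vert z.2) Ehat z = 2 * Ehat z)
  (Ghat_eq : forall z c, U z ->
     ddJ Ehat Ghat (cst (c, 0)) z = - dact (cst (c, 0)) Ehat z)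
  (Ehat_rank : forall z, U z -> ddJ_max_rank Ehat z).

Let hF z v : U z -> has_derivative F z v ('D_v F z).
Proof. by move=> Uz; apply: has_derivativeP; exact: smooth_differentiable sF Uz. Qed.

Let hPhi z v : U z -> has_derivative Phi z v ('D_v Phi z).
Proof. by move=> Uz; apply: has_derivativeP; exact: smooth_differentiable sPhi Uz. Qed.

Let eF := matsumoto_dF F Phi.
Let eP := matsumoto_dPhi F Phi.

Let sE : smooth_on U (energy F).
Proof.
by apply: (smoothM oU); [exact: (smooth_cst oU)|exact: (smoothX oU)].
Qed.

Let sEhat : smooth_on U Ehat.
Proof.
apply: (smoothM oU); [exact: (smooth_cst oU)|apply: (smoothX oU)].
apply: (smoothM oU); first exact: (smoothX oU).
by apply: (smoothV oU) => //; exact: (smoothB oU).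
Qed.

Let st3 : smooth_on U (fun z => ((F z - Phi z) ^+ 3)^-1).
Proof.
apply: (smoothV oU); first by move=> z Uz; rewrite expf_neq0 ?t0.
by apply: (smoothX oU); exact: (smoothB oU).
Qed.

Let seF : smooth_on U eF.
Proof.
apply: (smoothM oU) => //; apply: (smoothM oU); first exact: (smoothX oU).
apply: (smoothB oU) => //; apply: (smoothM oU) => //; exact: (smooth_cst oU).
Qed.

Let seP : smooth_on U eP.
Proof. by apply: (smoothM oU) => //; exact: (smoothX oU). Qed.

Lemma derive_energyE z v : U z -> 'D_v (energy F) z = F z * 'D_v F z.
Proof. by move=> Uz; exact: derive_energy (hF v Uz). Qed.

Lemma derive_Ehat z v : U z ->
  'D_v Ehat z = eF z * 'D_v F z + eP z * 'D_v Phi z.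
Proof.
by move=> Uz; exact: derive_matsumoto_energy (hF v Uz) (hPhi v Uz) (t0 Uz).
Qed.

(** (beta c).E = 0 and F != 0 give (beta c).F = 0, so Ehat varies horizontally through Phi only. *)
Lemma Ehat_horizontal z c : U z ->
  'D_(hmap G (cst c) z) Ehat z = - (eP z * (F z * 'D_(vert c) F z)).
Proof.
move=> Uz; rewrite derive_Ehat// Phi_horizontal// derive_energyE// mulrN.
have := horizontal_energy oU sG G1 sE E_euler G_eq c Uz.
rewrite derive_energyE// => /eqP; rewrite mulf_eq0 (negbTE (F0 Uz)) /= => /eqP ->.
by rewrite mulr0 add0r.
Qed.

(** By 2-homogeneity of its fibre part, G is the horizontal lift of eta; G.Ehat is thus the case c =
    y of [Ehat_horizontal]. *)
Lemma spray_hmap z : U z -> G z = hmap G (cst z.2) z.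
Proof.
move=> Uz; rewrite (hmapE oU sG G1 _ Uz) G_hom// scalerA mulVf ?pnatr_eq0//.
by rewrite scale1r [LHS]surjective_pairing G1.
Qed.

Lemma derive_eta_F z : U z -> 'D_(vert z.2) F z = F z.
Proof.
move=> Uz; have := E_euler Uz; rewrite derive_energyE// /energy => FE.
by apply: (mulfI (F0 Uz)); rewrite FE; field.
Qed.

Lemma Ehat_spray z : U z -> 'D_(G z) Ehat z = - (eP z * F z ^+ 2).
Proof.
by move=> Uz; rewrite spray_hmap// Ehat_horizontal// derive_eta_F// expr2.
Qed.

Lemma derive_Ehat_spray z c : U z -> 'D_(vert c) (fun y => 'D_(G y) Ehat y) z =
  - ('D_(vert c) eP z * F z ^+ 2 + 2 * eP z * F z * 'D_(vert c) F z).
Proof.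
move=> Uz.
have hP := has_derivativeP (vert c) (smooth_differentiable seP Uz).
have [_ D1] := has_derivativeM (has_derivative_cst (-1) z (vert c))
  (has_derivativeM hP (has_derivativeX 1 (hF (vert c) Uz))).
have -> : 'D_(vert c) (fun y => 'D_(G y) Ehat y) z =
    'D_(vert c) (fun y => -1 * (eP y * F y ^+ 2)) z.
  by apply: (derive_eq_on _ oU) Uz => y Uy; rewrite mulN1r; exact: Ehat_spray.
by rewrite D1; ring.
Qed.

Let P z := (Ghat z).2 - (G z).2.

Lemma spray_difference z c : U z ->
  'D_(vert (P z)) (fun y => 'D_(vert c) Ehat y) z = F z ^+ 2 * 'D_(vert c) eP z.
Proof.
move=> Uz; have dE := smooth_differentiable sEhat Uz.
have GhatE : Ghat z = G z + vert (P z).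
  rewrite [LHS]surjective_pairing [RHS]surjective_pairing /= addr0 Ghat1// G1//.
  by rewrite /P addrC subrK.
have e1 := spray_equation oU sGhat Ghat1 sEhat Ehat_euler Ghat_eq c Uz.
have dcE := smooth_differentiable (smooth_derive (vert c) sEhat) Uz.
have e2 := derive_along_spray oU sG G1 c sEhat Uz.
have e3 := derive_Ehat_spray c Uz.
have e4 : 'D_(c, 0) Ehat z + 'D_(c, 'D_(vert c) (fun y => (G y).2) z) Ehat z =
    2 * 'D_(hmap G (cst c) z) Ehat z.
  rewrite -(derive_dirD _ _ dE) (hmap_double oU sG G1 _ Uz).
  exact: (derive_dirZ _ _ dE).
have e5 : 'D_(Ghat z) (fun y => 'D_(vert c) Ehat y) z =
    'D_(G z) (fun y => 'D_(vert c) Ehat y) z +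
    'D_(vert (P z)) (fun y => 'D_(vert c) Ehat y) z.
  by rewrite GhatE; exact: derive_dirD.
have e6 := Ehat_horizontal c Uz.
exact: (spray_difference_arith e1 e2 e3 e4 e5 e6).
Qed.

Variables (f1 f2 : T -> R).
Hypotheses (f1E : forall z, U z -> f1 z =
    F z * (4 * Phi z - F z) / (F z * (1 + 2 * p2 z) - 3 * Phi z))
  (f2E : forall z, U z -> f2 z =
    2 * F z ^+ 3 / (F z * (1 + 2 * p2 z) - 3 * Phi z)).

Let P0 z := - f1 z *: z.2 + f2 z *: phi z.

Lemma derive_P0 (f : T -> R) z : U z -> differentiable f z ->
  'D_(vert (P0 z)) f z = - f1 z * 'D_(vert z.2) f z + f2 z * 'D_(vert (phi z)) f z.
Proof.
move=> Uz df; rewrite /P0 vertD !vertZ (derive_dirD _ _ df).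
by rewrite (derive_dirZ _ (vert z.2) df) (derive_dirZ _ (vert (phi z)) df).
Qed.

(** Differentiating d_c Ehat = e_F d_c F + e_Phi d_c Phi produces second derivatives of F and Phi.
    That of Phi vanishes; that of F is traded for the one of E, known from d_eta d_c E = d_c E and
    d_phi d_c E = d_c Phi. *)
Lemma spray_candidate z c : U z ->
  'D_(vert (P0 z)) (fun y => 'D_(vert c) Ehat y) z = F z ^+ 2 * 'D_(vert c) eP z.
Proof.
move=> Uz; set v := vert (P0 z).
have hcF := has_derivativeP v (smooth_differentiable (smooth_derive (vert c) sF) Uz).
have hcP := has_derivativeP v (smooth_differentiable (smooth_derive (vert c) sPhi) Uz).
have heF := has_derivativeP v (smooth_differentiable seF Uz).
have heP := has_derivativeP v (smooth_differentiable seP Uz).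
have dE := smooth_differentiable sE Uz.
have dcE := smooth_differentiable (smooth_derive (vert c) sE) Uz.
have dPhi := smooth_differentiable sPhi Uz.
have -> : 'D_v (fun y => 'D_(vert c) Ehat y) z =
    'D_v (fun y => eF y * 'D_(vert c) F y + eP y * 'D_(vert c) Phi y) z.
  by apply: (derive_eq_on _ oU) Uz => y Uy; exact: derive_Ehat.
have [_ ->] := has_derivativeD (has_derivativeM heF hcF) (has_derivativeM heP hcP).
rewrite /v Phi_vert2// -/v mulr0 addr0.
rewrite (derive_matsumoto_dF (hF v Uz) (hPhi v Uz) (t0 Uz)).
rewrite (derive_matsumoto_dPhi (hF v Uz) (hPhi v Uz) (t0 Uz)).
rewrite (derive_matsumoto_dPhi (hF (vert c) Uz) (hPhi (vert c) Uz) (t0 Uz)).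
have -> : 'D_v Phi z = - f1 z * Phi z + f2 z * p2 z.
  by rewrite derive_P0// Phi_euler// p2E.
have dFE : F z * 'D_v F z = - f1 z * F z ^+ 2 + f2 z * Phi z.
  by rewrite -derive_energyE// derive_P0// -PhiE// E_euler// /energy; field.
have D1 : 'D_v (fun y => F y * 'D_(vert c) F y) z =
    'D_v (fun y => 'D_(vert c) (energy F) y) z.
  by apply: (derive_eq_on _ oU) Uz => y Uy; rewrite derive_energyE.
have dFuE : F z * 'D_v (fun y => 'D_(vert c) F y) z + 'D_v F z * 'D_(vert c) F z =
    - f1 z * (F z * 'D_(vert c) F z) + f2 z * 'D_(vert c) Phi z.
  rewrite addrC -(has_derivativeM (hF v Uz) hcF).2 D1 (derive_P0 Uz dcE).
  rewrite -Phi_vert//; congr (_ * _ + _).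
  rewrite (derive_sym oU _ _ sE Uz) (derive_euler oU sE E_euler _ Uz) /=.
  by rewrite derive_energyE//; ring.
have f1N : - f1 z = - (F z * (4 * Phi z - F z) / (F z * (1 + 2 * p2 z) - 3 * Phi z)).
  by rewrite f1E.
exact: (matsumoto_spray_identity (F0 Uz) (t0 Uz) (Q0 Uz) f1N (f2E Uz) dFE dFuE).
Qed.

Lemma matsumoto_spray z : U z ->
  (Ghat z).2 = (G z).2 + (- f1 z *: z.2 + f2 z *: phi z).
Proof.
move=> Uz; apply/eqP; rewrite addrC -subr_eq -subr_eq0; apply/eqP.
apply: (ddJ_nondegenerate oU sEhat Uz (Ehat_rank Uz)) => c.
have dcE := smooth_differentiable (smooth_derive (vert c) sEhat) Uz.
rewrite -/(P z) -/(P0 z) vertD vertN (derive_dirD _ _ dcE) (derive_dirN _ dcE).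
by rewrite spray_difference// spray_candidate// subrr.
Qed.

End MatsumotoSpray.

(** * Comparison of the Berwald connections *)

Section BerwaldComparison.
Context {R : realType} {n : nat} {U : set (tpoint R n)}.
Hypothesis oU : open U.
Local Notation T := (tpoint R n).
Local Notation E := 'rV[R]_n.
Variables (G Ghat : T -> T) (f1 f2 : T -> R) (phi : T -> E).
Hypotheses (sG : smooth_on U G) (G1 : forall z, U z -> (G z).1 = z.2)
  (sGhat : smooth_on U Ghat) (Ghat1 : forall z, U z -> (Ghat z).1 = z.2)
  (sf1 : smooth_on U f1) (sf2 : smooth_on U f2) (sphi : smooth_on U phi)
  (phi_basic : forall z c, U z -> 'D_(vert c) phi z = 0)
  (Ghat2 : forall z, U z ->
     (Ghat z).2 = (G z).2 + (- f1 z *: z.2 + f2 z *: phi z)).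
Let S y := (G y).2.
Let Shat y := (Ghat y).2.
Let sS : smooth_on U S := smooth_snd oU sG.

Lemma derive_Shat z w : U z -> 'D_(vert w) Shat z = 'D_(vert w) S z +
  (- ('D_(vert w) f1 z *: z.2 + f1 z *: w) + 'D_(vert w) f2 z *: phi z).
Proof.
move=> Uz; rewrite (derive_eq_on (vert w) oU Ghat2 Uz).
have dS := smooth_differentiable sS Uz.
have [d1 D1] := derive_scale (vert w) (smooth_differentiable sf1 Uz)
  (smooth_differentiable (smooth_eta oU) Uz).
have [d2 D2] := derive_scale (vert w) (smooth_differentiable sf2 Uz)
  (smooth_differentiable sphi Uz).
rewrite derive_eta in D1; rewrite phi_basic// scaler0 addr0 in D2.
have -> : (fun z => (G z).2 + (- f1 z *: z.2 + f2 z *: phi z)) =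
    (fun z => S z + (- (f1 z *: etabar z) + f2 z *: phi z)).
  by apply/funext => y; rewrite scaleNr.
have dN := differentiableN d1.
rewrite deriveD; [|exact: diff_derivable|]; last first.
  by apply: diff_derivable; exact: differentiableD.
by rewrite deriveD ?deriveN ?D1 ?D2//; exact: diff_derivable.
Qed.

Lemma derive2_Shat z w c : U z ->
  'D_(vert c) (fun y => 'D_(vert w) Shat y) z =
  'D_(vert c) (fun y => 'D_(vert w) S y) z +
  (- ('D_(vert c) (fun y => 'D_(vert w) f1 y) z *: z.2 + 'D_(vert w) f1 z *: c
      + 'D_(vert c) f1 z *: w)
   + 'D_(vert c) (fun y => 'D_(vert w) f2 y) z *: phi z).
Proof.
move=> Uz; rewrite (derive_eq_on (vert c) oU (fun y => derive_Shat w (z := y)) Uz).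
have dS := smooth_differentiable (smooth_derive (vert w) sS) Uz.
have [d1 D1] := derive_scale (vert c)
  (smooth_differentiable (smooth_derive (vert w) sf1) Uz)
  (smooth_differentiable (smooth_eta oU) Uz).
have [d2 D2] := derive_scale (vert c)
  (smooth_differentiable (smooth_derive (vert w) sf2) Uz)
  (smooth_differentiable sphi Uz).
have [d3 D3] := derive_scale (vert c) (smooth_differentiable sf1 Uz)
  (differentiable_cst w z).
rewrite derive_eta in D1; rewrite phi_basic// scaler0 addr0 in D2.
rewrite derive_cst scaler0 addr0 in D3.
have d13 := differentiableD d1 d3.
have dN := differentiableN d13.
rewrite deriveD; [|exact: diff_derivable|]; last first.
  by apply: diff_derivable; exact: differentiableD.
rewrite deriveD; [|exact: diff_derivable|exact: diff_derivable].
rewrite deriveN; last exact: diff_derivable.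
rewrite deriveD; [|exact: diff_derivable|exact: diff_derivable].
by rewrite D1 D2 D3.
Qed.

(** b and a are the derivatives of Z along the two horizontal lifts of W; dy, dw, dp those along
    eta, W, phi; s is d_Z d_W S; y, w, c, p stand for eta, W, Z, phi; k is f1, l1 and l2 are the
    derivatives of f1 and f2 along W, m that of f1 along Z, m1 and m2 the second derivatives. *)
Lemma connection_arith (b a s dy dw dp y w c p : E) (k l1 l2 m m1 m2 : R) :
  b = a - 2^-1 *: (l1 *: dy + k *: dw - l2 *: dp) ->
  b - 2^-1 *: (s + (- (m1 *: y + l1 *: c + m *: w) + m2 *: p)) =
  a - 2^-1 *: s
    - 2^-1 *: (k *: dw + l1 *: dy - l1 *: c - m *: w - l2 *: dp)
    + 2^-1 *: (m1 *: y - m2 *: p).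
Proof. by move=> ->; apply/rowP => j; rewrite !mxE; field. Qed.

Lemma derive_dir_comb (f : T -> E) z (b u v w : T) (l k m : R) :
  differentiable f z ->
  'D_(b - 2^-1 *: (l *: u + k *: v - m *: w)) f z =
  'D_b f z - 2^-1 *: (l *: 'D_u f z + k *: 'D_v f z - m *: 'D_w f z).
Proof. by move=> df; rewrite !deriveE// linearB linearZ linearB linearD !linearZ. Qed.

Lemma berwald_hmap_hat (W Z : T -> E) z :
  smooth_on U W -> smooth_on U Z -> U z ->
  berwald Ghat (hmap Ghat W) Z z = berwald G (hmap G W) Z z
  - 2^-1 *: (f1 z *: 'D_(vert (W z)) Z z
             + 'D_(vert (W z)) f1 z *: 'D_(vert z.2) Z z
             - 'D_(vert (W z)) f1 z *: Z z - 'D_(vert (Z z)) f1 z *: W z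
             - 'D_(vert (W z)) f2 z *: 'D_(vert (phi z)) Z z)
  + 2^-1 *: ('D_(vert (Z z)) (fun y => 'D_(vert (W z)) f1 y) z *: z.2
             - 'D_(vert (Z z)) (fun y => 'D_(vert (W z)) f2 y) z *: phi z).
Proof.
move=> sW sZ Uz; have dZ := smooth_differentiable sZ Uz.
rewrite (berwald_hmap oU sG G1 sW sZ Uz) (berwald_hmap oU sGhat Ghat1 sW sZ Uz).
rewrite (derive2_Shat _ _ Uz).
have hE : hmap Ghat W z = hmap G W z - 2^-1 *: ('D_(vert (W z)) f1 z *: vert z.2
    + f1 z *: vert (W z) - 'D_(vert (W z)) f2 z *: vert (phi z)).
  rewrite (hmapE oU sGhat Ghat1 _ Uz) (hmapE oU sG G1 _ Uz) (derive_Shat _ Uz).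
  rewrite -!vertZ -vertD -vertN -vertD -vertZ -vertN.
  rewrite [RHS]surjective_pairing /= addr0; congr pair.
  by rewrite scalerDr -scalerN opprB [- _ + _]addrC.
have eh := etrans (congr1 (fun v => 'D_v Z z) hE) (derive_dir_comb _ _ _ _ _ _ _ dZ).
exact: connection_arith eh.
Qed.

End BerwaldComparison.

(** * From the global hypotheses to identities in one chart *)

Section FinslerCharts.
Context {R : realType} {n : nat} {M : manifold R n}.
Local Notation T := (tpoint R n).
Local Notation E := 'rV[R]_n.
Variable i : atlas M.
Local Notation SL := (@slit R n M i).

Lemma slit_open : open SL.
Proof.
have -> : SL = (fst @^-1` (chart i @` chart_dom i)) `&` (snd @^-1` (~` [set 0])).
  by apply/seteqP; split=> z /= [z1 /eqP z2].
apply: openI; apply: open_comp.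
- by move=> z _; exact: cvg_fst.
- exact: chart_open.
- by move=> z _; exact: cvg_snd.
- apply: closed_openC; apply: accessible_closed_set1; apply: hausdorff_accessible.
  exact: norm_hausdorff.
Qed.

(** J G = C fixes the base component of G, and the fibre component of [C, G] = G reads d_y S - S =
    S. *)
Lemma spray_components (U : set T) (G : T -> T) : open U ->
  smooth_on U G ->
  (forall z, U z -> Jop G z = liouville z) ->
  (forall z, U z -> lie_br (@liouville R n) G z = G z) ->
  (forall z, U z -> (G z).1 = z.2) /\
  (forall z, U z -> 'D_(vert z.2) (fun y => (G y).2) z = 2 *: (G z).2).
Proof.
move=> oU sG GJ GC; have G1 z : U z -> (G z).1 = z.2.
  by move=> Uz; have := congr1 snd (GJ z Uz).
split=> // z Uz; have := GC z Uz; rewrite /lie_br.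
have -> : liouville z = vert z.2 by [].
have dG := smooth_differentiable sG Uz.
have -> : 'D_(G z) (@liouville R n) z = vert (G z).2.
  rewrite -(derive_eta (G z) z); apply: derive_vlift.
  exact: smooth_differentiable (smooth_eta oU) Uz.
move=> /(congr1 snd).
have sndB (a b : T) : (a - b).2 = a.2 - b.2 by [].
rewrite sndB (derive_snd _ dG) => /eqP; rewrite subr_eq => /eqP ->.
by rewrite scaler_nat mulr2n.
Qed.

(** [fmetric] differentiates its arguments, so the vanishing is required on an open set; it also
    supplies the smoothness that [fmetricE] asks for. *)
Lemma fmetric_eq0l (U : set T) (f : T -> R) (X Y : T -> E) z : open U ->
  smooth_on U f -> smooth_on U Y -> (forall y, U y -> X y = 0) -> U z ->
  fmetric f X Y z = 0.
Proof.
move=> oU sf sY X0 Uz.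
have sX : smooth_on U X.
  by apply: (smooth_eq_on oU _ (smooth_cst oU (0 : E))) => y Uy; rewrite X0.
by rewrite (fmetricE oU sf sX sY Uz) X0// vert0 derive0.
Qed.

Lemma fmetric_eq0r (U : set T) (f : T -> R) (X Y : T -> E) z : open U ->
  smooth_on U f -> smooth_on U X -> (forall y, U y -> Y y = 0) -> U z ->
  fmetric f X Y z = 0.
Proof.
move=> oU sf sX Y0 Uz.
have sY : smooth_on U Y.
  by apply: (smooth_eq_on oU _ (smooth_cst oU (0 : E))) => y Uy; rewrite Y0.
rewrite (fmetricE oU sf sX sY Uz) Y0//.
have -> : (fun y => 'D_(vert 0) f y) = cst 0.
  by apply/funext => y; rewrite vert0 derive0.
exact: derive_cst.
Qed.

Lemma energy_homogeneous (U : set T) (F : T -> R) : open U -> smooth_on U F ->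
  (forall z (t : R), U z -> 0 < t -> F (z.1, t *: z.2) = t * F z) ->
  smooth_on U (energy F) /\
  forall z, U z -> 'D_(vert z.2) (energy F) z = 2 * energy F z.
Proof.
move=> oU sF Fh; have sE : smooth_on U (energy F).
  by apply: (smoothM oU); [exact: (smooth_cst oU)|exact: (smoothX oU)].
split=> // z Uz; apply: (homogeneous_euler (k := 2) sE _ Uz) => y t Uy t_gt0.
by rewrite /energy Fh// exprMn mulrCA.
Qed.

(** In the vertical Cartan formula for phi and constant c, d, the left side is 0 by concurrence and
    the two brackets reduce to d_c d = 0 and d_c phi = 0; only the derivative of g(phi, d) along
    gamma(c) remains. *)
Lemma cartan_vertical (F : atlas M -> T -> R) (G : atlas M -> T -> T)
    (nabla : atlas M -> (T -> T) -> (T -> E) -> (T -> E))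
    (phi : atlas M -> T -> E) :
  smooth_on SL (energy (F i)) -> smooth_on SL (G i) ->
  (forall z, SL z -> (G i z).1 = z.2) -> cartan_connection F G nabla ->
  smooth_on SL (phi i) ->
  (forall z c, SL z -> 'D_(vert c) (phi i) z = 0) ->
  (forall z c, SL z -> nabla i (vlift (cst c)) (phi i) z = 0) ->
  forall z c d, SL z -> 'D_(vert c) (fun y => 'D_(vert (phi i y))
    (fun x => 'D_(vert d) (energy (F i)) x) y) z = 0.
Proof.
move=> sE sG G1 [snabla cartan] sphi phi_basic nabla0 z c d Uz.
have oSL := slit_open.
have sc (a : E) : smooth_on SL (cst a : T -> E) by exact: (smooth_cst oSL).
have [] := cartan i (cst c) (phi i) (cst d) (sc c) sphi (sc d) z Uz.
move=> + _; rewrite (fmetric_eq0l oSL sE (sc d) _ Uz); last first.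
  by move=> y Uy; exact: nabla0.
rewrite (fmetric_eq0r oSL sE sphi _ Uz); last first.
  move=> y Uy.
  have -> : forall X Y, rho (lie_br X Y) y = - rho (lie_br Y X) y.
    by move=> X Y; rewrite /rho /lie_br /= opprB.
  by rewrite (rho_lie_br_hmap oSL sG G1 (sc c) (sc d) Uy) derive_cst oppr0.
rewrite (fmetric_eq0r oSL sE (sc d) _ Uz); last first.
  move=> y Uy; rewrite (rho_lie_br_hmap oSL sG G1 (sc c) sphi Uy).
  exact: phi_basic.
rewrite mulr0 !addr0 => /esym.
have e y : SL y -> fmetric (energy (F i)) (phi i) (cst d) y =
    'D_(vert (phi i y)) (fun x => 'D_(vert d) (energy (F i)) x) y.
  by move=> Uy; exact: (fmetricE oSL sE sphi (sc d) Uy).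
by rewrite -(derive_eq_on _ oSL e Uz).
Qed.

End FinslerCharts.

Theorem proposition3p5 (R : realType) (n : nat) (M : manifold R n)
  (F : atlas M -> tpoint R n -> R)
  (G : atlas M -> tpoint R n -> tpoint R n)
  (nabla : atlas M -> (tpoint R n -> tpoint R n) ->
           (tpoint R n -> 'rV[R]_n) -> (tpoint R n -> 'rV[R]_n))
  (phi : atlas M -> tpoint R n -> 'rV[R]_n)
  (Ghat : atlas M -> tpoint R n -> tpoint R n)
  (F_finsler : finsler F)
  (G_spray : geodesic_spray (@slit R n M) (fun i => energy (F i)) G)
  (nabla_cartan : cartan_connection F G nabla)
  (phi_concurrent : concurrent G nabla phi)
  (Fhat_conic : conic_pseudo_finsler (matsumoto_dom F phi)
                  (fun i => matsumoto (F i) (phi i)))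
  (Ghat_spray : geodesic_spray (matsumoto_dom F phi)
                  (fun i => energy (matsumoto (F i) (phi i))) Ghat)
  (den_neq0 : forall i z, matsumoto_dom F phi i z ->
                matsumoto_den (F i) (phi i) z != 0) :
  forall (i : atlas M) (W Z : tpoint R n -> 'rV[R]_n),
  smooth_on (matsumoto_dom F phi i) W ->
  smooth_on (matsumoto_dom F phi i) Z ->
  let f1 := fun z => F i z * (4 * phi_eta (F i) (phi i) z - F i z)
                     / matsumoto_den (F i) (phi i) z in
  let f2 := fun z => 2 * F i z ^+ 3 / matsumoto_den (F i) (phi i) z in
  let D := berwald (G i) in
  let Dhat := berwald (Ghat i) in
  let b := hmap (G i) in
  let bhat := hmap (Ghat i) in
  forall z, matsumoto_dom F phi i z ->
  Dhat (vlift W) Z z = D (vlift W) Z z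
  /\
  Dhat (bhat W) Z z =
    D (b W) Z z
    - 2^-1 *: (f1 z *: D (vlift W) Z z
               + dJ f1 (b W) z *: D (vlift (@etabar R n)) Z z
               - dJ f1 (b W) z *: Z z
               - dJ f1 (b Z) z *: W z
               - dJ f2 (b W) z *: D (vlift (phi i)) Z z)
    + 2^-1 *: (ddJ f1 (vlift Z) (b W) z *: etabar z
               - ddJ f2 (vlift Z) (b W) z *: phi i z).
Proof.
move=> i W Z sW sZ f1 f2 D Dhat b bhat z Az.
pose A := matsumoto_dom F phi i.
pose SL := @slit R n M i.
have [_ _ [Fsmooth _] Fhom Fpos] := F_finsler.
have [Gsmooth _ GJ GC Gspray] := G_spray.
have [phismooth _ _ phicon] := phi_concurrent.
have [[_ [Aopen Asub] _ _ _] [_ Fhsmooth] _ Fhhom Fhrank] := Fhat_conic.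
have [Ghsmooth _ GhJ GhC Ghspray] := Ghat_spray.
have oSL : open SL by exact: slit_open.
have oA : open A by exact: Aopen.
have sub : A `<=` SL by exact: Asub.
have sF : smooth_on SL (F i) by exact: Fsmooth.
have sG : smooth_on SL (G i) by exact: Gsmooth.
have sphi : smooth_on SL (phi i) by exact: phismooth.
have sGh : smooth_on A (Ghat i) by exact: Ghsmooth.
have [G1 G_hom] := spray_components oSL sG (GJ i) (GC i).
have [Gh1 _] := spray_components oA sGh (GhJ i) (GhC i).
have [sE E_euler] := energy_homogeneous oSL sF (fun z t Sz => Fhom i z t Sz.1).
have sc (U : set (tpoint R n)) (oU : open U) (W' : normedModType R) (c : W') :
  smooth_on U (cst c : tpoint R n -> W') by exact: (smooth_cst oU).
have G_eq y c : SL y -> ddJ (energy (F i)) (G i) (cst (c, 0)) y =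
    - dact (cst (c, 0)) (energy (F i)) y.
  by move=> Sy; apply: Gspray Sy; exact: sc.
have phi_basic y c : SL y -> 'D_(vert c) (phi i) y = 0.
  move=> Sy; have [_ _ _] := phicon i (cst c) (sc _ oSL _ c) y Sy.
  by rewrite (berwald_vlift oSL sG G1 (sc _ oSL _ c) sphi Sy).
have phi_hor y c : SL y -> 'D_(hmap (G i) (cst c) y) (phi i) y
     - 2^-1 *: 'D_(vert (phi i y)) (fun x => 'D_(vert c) (fun x => (G i x).2) x) y
     = - c.
  move=> Sy; have [_ + _ _] := phicon i (cst c) (sc _ oSL _ c) y Sy.
  by rewrite (berwald_hmap oSL sG G1 (sc _ oSL _ c) sphi Sy).
have nabla0 y c : SL y -> nabla i (vlift (cst c)) (phi i) y = 0.
  by move=> Sy; have [_ _ + _] := phicon i (cst c) (sc _ oSL _ c) y Sy.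
have phi_cartan := cartan_vertical sE sG G1 nabla_cartan sphi phi_basic nabla0.
(* [phi_eta] and [phi_form] agree on the slit domain, hence so do their derivatives there; the facts
   proved for the latter are carried over to the former. *)
pose Phi := phi_form (energy (F i)) (phi i).
have sPhi : smooth_on SL Phi := smooth_phi_form oSL sE sphi.
have phi_etaE y : SL y -> phi_eta (F i) (phi i) y = Phi y.
  move=> Sy; rewrite /phi_eta (fmetricE oSL sE sphi (smooth_eta oSL) Sy).
  apply: etrans (derive_euler oSL sE E_euler (vert (phi i y)) Sy) _.
  by rewrite mulr_natl mulr2n addrK.
have derive_phi_eta y v : SL y -> 'D_v (phi_eta (F i) (phi i)) y = 'D_v Phi y.
  exact: (derive_eq_on v oSL phi_etaE).
have psqE y : SL y -> psq (F i) (phi i) y = 'D_(vert (phi i y)) Phi y.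
  move=> Sy; rewrite /psq (fmetricE oSL sE sphi sphi Sy).
  exact/esym/(phi_form_vert oSL sE sphi phi_basic).
(* Concurrence is exploited on the slit domain, where it is stated; W, Z and Ghat live on [A], to
   which the facts are now restricted. *)
have restrict (W' : normedModType R) (f : tpoint R n -> W') :
  smooth_on SL f -> smooth_on A f by exact: smooth_subset.
have sPhi_eta : smooth_on A (phi_eta (F i) (phi i)).
  by apply: restrict; apply: (smooth_eq_on oSL _ sPhi) => y Sy; rewrite phi_etaE.
have spsq : smooth_on A (psq (F i) (phi i)).
  apply: restrict; apply: (smooth_eq_on oSL _ (smooth_vderive oSL sPhi sphi)) => y Sy.
  by rewrite psqE.
have sden : smooth_on A (matsumoto_den (F i) (phi i)).
  have sFA := restrict _ _ sF.
  apply: (smoothB oA); apply: (smoothM oA) => //; last exact: sc.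
  apply: (smoothD oA); first exact: sc.
  by apply: (smoothM oA) => //; exact: sc.
have sdenV : smooth_on A (fun y => (matsumoto_den (F i) (phi i) y)^-1).
  by apply: (smoothV oA) => // y Ay; exact: den_neq0.
have sf1 : smooth_on A f1.
  have sFA := restrict _ _ sF.
  apply: (smoothM oA) => //; apply: (smoothM oA) => //; apply: (smoothB oA) => //.
  by apply: (smoothM oA) => //; exact: sc.
have sf2 : smooth_on A f2.
  have sFA := restrict _ _ sF.
  apply: (smoothM oA) => //; apply: (smoothM oA); first exact: sc.
  exact: (smoothX oA).
(* Euler's relation gives g(y, y) = 2 E = F^2, so positive definiteness excludes zeros of F off the
   zero section. *)
have F0 y : SL y -> F i y != 0.
  move=> Sy; have [_ /(_ y.2 Sy.2)] := Fpos i y Sy.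
  rewrite (fmetricE oSL sE (sc _ oSL _ y.2) (sc _ oSL _ y.2) Sy).
  have -> := derive_euler oSL sE E_euler (vert y.2) Sy.
  rewrite E_euler// /energy; apply: contraTneq => ->.
  by rewrite expr0n /= !mulr0 subr0 ltxx.
have [sEh Eh_euler] := energy_homogeneous oA (Fhsmooth i) (Fhhom i).
have Gh2 y : A y -> (Ghat i y).2 = (G i y).2 + (- f1 y *: y.2 + f2 y *: phi i y).
  move=> Ay; have Sy := sub _ Ay.
  apply: (@matsumoto_spray _ _ A oA (G i) (Ghat i) (F i) (phi_eta (F i) (phi i))
    (psq (F i) (phi i)) (phi i)) => //.
  - exact: restrict.
  - by move=> x /sub; exact: G1.
  - by move=> x /sub; exact: G_hom.
  - by move=> x c /sub; exact: G_eq.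
  - exact: restrict.
  - by move=> x /sub; exact: F0.
  - by move=> x /sub; exact: E_euler.
  - by move=> x [_ xA]; rewrite subr_eq0 gt_eqF.
  - by move=> x Ax; exact: den_neq0.
  - by move=> x /sub; exact: phi_etaE.
  - by move=> x /sub Sx; rewrite (psqE _ Sx) (derive_phi_eta _ _ Sx).
  - move=> x c /sub Sx; rewrite (derive_phi_eta _ _ Sx).
    exact: (phi_form_vert oSL sE sphi phi_basic).
  - move=> x c d /sub Sx.
    rewrite (derive_eq_on (vert c) oSL (fun y => derive_phi_eta y (vert d)) Sx).
    exact: (phi_form_vert2 oSL sE sphi phi_basic phi_cartan).
  - move=> x /sub Sx; rewrite (derive_phi_eta _ _ Sx) (phi_etaE _ Sx).
    exact: (phi_form_eta oSL sE E_euler sphi phi_basic).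
  - move=> x c /sub Sx; rewrite (derive_phi_eta _ _ Sx).
    exact: (phi_form_horizontal oSL sG G1 sE E_euler G_eq sphi phi_hor).
  - by move=> x c Ax; apply: Ghspray Ax; exact: sc.
  - exact: Fhrank.
have G1A y : A y -> (G i y).1 = y.2 by move=> /sub; exact: G1.
have sGA := restrict _ _ sG.
have phi_basicA y c : A y -> 'D_(vert c) (phi i) y = 0 by move=> /sub; exact: phi_basic.
have sphiA := restrict _ _ sphi.
rewrite /D /Dhat /b /bhat.
rewrite (berwald_vlift oA sGA G1A sW sZ Az) (berwald_vlift oA sGh Gh1 sW sZ Az).
split=> //.
have dJhmap f X : dJ f (hmap (G i) X) z = 'D_(vert (X z)) f z.
  by rewrite dJE (hmapE oA sGA G1A _ Az).
have ddJhmap f : smooth_on A f -> ddJ f (vlift Z) (hmap (G i) W) z =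
    'D_(vert (Z z)) (fun y => 'D_(vert (W z)) f y) z.
  move=> sf; rewrite (ddJ_vlift oA sf sZ (smooth_hmap oA sGA G1A sW) Az).
  by rewrite (hmapE oA sGA G1A _ Az).
rewrite !dJhmap !ddJhmap//.
rewrite (berwald_vlift oA sGA G1A (smooth_eta oA) sZ Az).
rewrite (berwald_vlift oA sGA G1A sphiA sZ Az).
exact: (berwald_hmap_hat oA sGA G1A sGh Gh1 sf1 sf2 sphiA phi_basicA Gh2 sW sZ Az).
Qed.
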